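(* Let $k$ be an algebraically closed field, let $\Lambda=kK(3)$ be the path algebra of the $3$-Kronecker quiver, and let $(x,y)$ be a dimension vector, i.e. a pair of non-negative integers. Let $q(x,y)=x^2+y^2-3xy$. There exists an elementary $\Lambda$-module with dimension vector $(x,y)$ if and only if $q(x,y)$ is equal to $-1$ or $-4$.
   Context: The $3$-Kronecker quiver $K(3)$ has two vertices $1,2$ and three arrows $1\to 2$. A $\Lambda$-module is a finite-dimensional representation $M=(M_1,M_2;\alpha,\beta,\gamma)$ with three linear maps $M_1\to M_2$; its dimension vector is $(\dim M_1,\dim M_2)$. A module $M$ is preprojective if there are only finitely many isomorphism classes of indecomposable modules $X$ with $\operatorname{Hom}(X,M)\ne0$; preinjective if there are only finitely many isomorphism classes of indecomposable $X$ with $\operatorname{Hom}(M,X)\ne 0$; regular if it has no indecomposable direct summand which is preprojective or preinjective. A module $M$ is elementary if it is non-zero, regular, and there is no short exact sequence $0\to M'\to M\to M''\to 0$ with $M',M''$ non-zero regular modules. *)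

(* Defs.v *)
From HB Require Import structures.
From mathcomp Require Import all_boot all_order all_algebra.

Set Implicit Arguments.
Unset Strict Implicit.
Unset Printing Implicit Defensive.

Import GRing.Theory.
Local Open Scope ring_scope.

Record krep (k : fieldType) := KRep {
  vs1 : vectType k;
  vs2 : vectType k;
  alpha : 'Hom(vs1, vs2);
  beta : 'Hom(vs1, vs2);
  gamma : 'Hom(vs1, vs2)
}.

Definition dim_vector (k : fieldType) (M : krep k) : nat * nat :=
  (\dim {: vs1 M}, \dim {: vs2 M}).

Definition nonzero_rep (k : fieldType) (M : krep k) : Prop :=
  dim_vector M <> (0, 0)%N.

Record khom (k : fieldType) (M N : krep k) := KHom {
  hom1 : 'Hom(vs1 M, vs1 N);
  hom2 : 'Hom(vs2 M, vs2 N);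
  hom_alpha : (hom2 \o alpha M = alpha N \o hom1)%VF;
  hom_beta : (hom2 \o beta M = beta N \o hom1)%VF;
  hom_gamma : (hom2 \o gamma M = gamma N \o hom1)%VF
}.

Definition Hom_nonzero (k : fieldType) (M N : krep k) : Prop :=
  exists f : khom M N, ~ (hom1 f = 0 /\ hom2 f = 0).

Definition kiso (k : fieldType) (M N : krep k) : Prop :=
  exists (f : khom M N) (g : khom N M),
    [/\ (hom1 g \o hom1 f = \1)%VF, (hom1 f \o hom1 g = \1)%VF,
        (hom2 g \o hom2 f = \1)%VF & (hom2 f \o hom2 g = \1)%VF].

Section DirectSum.
Variables (k : fieldType) (U1 U2 V1 V2 : vectType k).
Variables (f : 'Hom(U1, V1)) (g : 'Hom(U2, V2)).

Definition dsum_fun (u : U1 * U2) : V1 * V2 := (f u.1, g u.2).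

Fact dsum_fun_is_linear : linear dsum_fun.
Proof. by move=> a u v; rewrite /dsum_fun !linearP. Qed.

HB.instance Definition _ :=
  GRing.isLinear.Build k (U1 * U2)%type (V1 * V2)%type *:%R dsum_fun
    dsum_fun_is_linear.

Definition dsum_lfun : 'Hom((U1 * U2)%type, (V1 * V2)%type) := linfun dsum_fun.
End DirectSum.

Definition dsum (k : fieldType) (M N : krep k) : krep k :=
  @KRep k (vs1 M * vs1 N)%type (vs2 M * vs2 N)%type
    (dsum_lfun (alpha M) (alpha N))
    (dsum_lfun (beta M) (beta N))
    (dsum_lfun (gamma M) (gamma N)).

Definition direct_summand (k : fieldType) (X M : krep k) : Prop :=
  exists Y : krep k, kiso M (dsum X Y).

Definition indecomposable (k : fieldType) (M : krep k) : Prop :=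
  nonzero_rep M /\
  forall A B : krep k, nonzero_rep A -> nonzero_rep B -> ~ kiso M (dsum A B).

Definition finitely_many_classes (k : fieldType) (P : krep k -> Prop) : Prop :=
  exists (n : nat) (F : 'I_n -> krep k),
    forall X : krep k, P X -> exists i : 'I_n, kiso X (F i).

Definition preprojective (k : fieldType) (M : krep k) : Prop :=
  finitely_many_classes (fun X => indecomposable X /\ Hom_nonzero X M).

Definition preinjective (k : fieldType) (M : krep k) : Prop :=
  finitely_many_classes (fun X => indecomposable X /\ Hom_nonzero M X).

(* The zero representation is regular. *)
Definition regular_rep (k : fieldType) (M : krep k) : Prop :=
  forall X : krep k, indecomposable X -> direct_summand X M ->
    ~ preprojective X /\ ~ preinjective X.

Definition short_exact (k : fieldType) (M' M M'' : krep k)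
    (f : khom M' M) (g : khom M M'') : Prop :=
  [/\ lker (hom1 f) = 0%VS /\ lker (hom2 f) = 0%VS,
      limg (hom1 f) = lker (hom1 g) /\ limg (hom2 f) = lker (hom2 g)
    & limg (hom1 g) = fullv /\ limg (hom2 g) = fullv].

Definition elementary (k : fieldType) (M : krep k) : Prop :=
  [/\ nonzero_rep M, regular_rep M
    & ~ exists (M' M'' : krep k) (f : khom M' M) (g : khom M M''),
        [/\ short_exact f g, nonzero_rep M', nonzero_rep M'',
            regular_rep M' & regular_rep M'']].

Definition kronecker_q (x y : nat) : int :=
  x%:Z ^+ 2 + y%:Z ^+ 2 - 3%:Z * x%:Z * y%:Z.

(* Main.v *)
Require Import Defs.
From HB Require Import structures.
From mathcomp Require Import all_boot all_order all_algebra.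
From mathcomp Require Import boolp realalg.
From mathcomp Require Import ring lra zify.

(** Write lam for the root (3 + sqrt 5) / 2 of t^2 = 3 t - 1.  The indecomposable
    preprojective (resp. preinjective) modules have slope dim M_2 / dim M_1
    above lam (resp. below 1 / lam), so a module is regular iff all its
    quotients have slope at most lam and all its submodules have slope at least
    1 / lam.  This numerical form of regularity behaves well under the
    reflection functors, which multiply the two weights by lam and 1 / lam, and
    under duality.  A Harder-Narasimhan argument shows that a regular module is
    not elementary as soon as it has a submodule U with slope of U below lam
    and slope of M / U above 1 / lam.  Reflections and duality reduce to
    2/3 <= slope <= 1.  There a submodule of dimension vector (1, 2) exists by
    solving det (a A + b B) = 0, and it destroys elementarity except for the
    dimension vectors (1,1), (2,2), (3,2), (4,3).  For (3,2) there is a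
    submodule of dimension vector (1,1), and for (4,3) one of dimension vector
    (2,2), because every net of 4 x 3 matrices contains a nonzero matrix of rank
    at most 2.  Conversely, (1,1) and (2,2) carry elementary modules, and the
    remaining dimension vectors are reached from them by reflections. *)

Set Implicit Arguments.
Unset Strict Implicit.
Unset Printing Implicit Defensive.
Import Order.TTheory GRing.Theory Num.Theory.
Import VectorInternalTheory.
Local Open Scope ring_scope.

(** * Subrepresentations and reflections *)

Section Subreps.
Variable k : fieldType.
Implicit Types m n l : nat.

(* Vectors are rows: the arrow i sends u to u *m A i. *)
Definition arrows m n := 'I_3 -> 'M[k]_(m, n).

Definition is_sub m n (A : arrows m n) (U1 : 'M[k]_m) (U2 : 'M[k]_n) :=
  forall i, (U1 *m A i <= U2)%MS.

Definition gen m n p (A : arrows m n) (U1 : 'M[k]_(p, m)) : 'M[k]_n :=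
  (\sum_i <<U1 *m A i>>)%MS.

(** The common preimage of [U1] under all three arrows: multiplying by [cokermx U1] kills exactly
    the vectors of [U1]. It is adjoint to [gen]. *)
Definition pre l m p (B : arrows l m) (U1 : 'M[k]_(p, m)) : 'M[k]_l :=
  kermx (\mxrow_i (B i *m cokermx U1)).

Definition dual m n (A : arrows m n) : arrows n m := fun i => (A i)^T.

(* The maps fit into an exact sequence 0 -> k^l -> k^m (x) k^3 -> k^n -> 0, so B
   is the reflection (Bernstein-Gelfand-Ponomarev) of A. *)
Definition refl l m n (A : arrows m n) (B : arrows l m) :=
  [/\ row_full (\mxcol_i A i), row_free (\mxrow_i B i),
      \sum_i B i *m A i = 0 & (l + n = 3 * m)%N].

Lemma gen_subP m n p q (A : arrows m n) (U1 : 'M_(p, m)) (U2 : 'M_(q, n)) :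
  (gen A U1 <= U2)%MS <-> (forall i, (U1 *m A i <= U2)%MS).
Proof.
split=> [s i|s]; last by apply/sumsmx_subP => i _; rewrite genmxE.
by apply: submx_trans s; apply: (sumsmx_sup i) => //; rewrite genmxE.
Qed.

Lemma is_sub_gen m n (A : arrows m n) U1 : is_sub A U1 (gen A U1).
Proof. by move=> i; move: i; apply/gen_subP. Qed.

Lemma sub_preP l m p q (B : arrows l m) (U1 : 'M_(p, m)) (W : 'M_(q, l)) :
  (W <= pre B U1)%MS <-> (forall i, (W *m B i <= U1)%MS).
Proof.
rewrite /pre sub_kermx mul_mxrow; split=> [/eqP e i|s].
  rewrite submxE -mulmxA; apply/eqP.
  by have := congr1 (fun X => submxrow X i) e; rewrite mxrowK submxrow0.
apply/eqP; rewrite -(mxrow0 _ (q_ := fun=> m)); apply/eq_mxrowP => i.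
by rewrite mulmxA; apply/eqP; rewrite -submxE.
Qed.

Lemma is_sub_pre l m (B : arrows l m) (U1 : 'M_m) : is_sub B (pre B U1) U1.
Proof. by apply/sub_preP. Qed.

Lemma preS l m p q (B : arrows l m) (U : 'M_(p, m)) (V : 'M_(q, m)) :
  (U <= V)%MS -> (pre B U <= pre B V)%MS.
Proof.
move=> s; apply/sub_preP => i; apply: submx_trans s.
by move: i; apply/sub_preP.
Qed.

(** The block diagonal matrix stands for the subspace U (x) k^3 of k^m (x) k^3. *)
Lemma sub_mxdiagP m q (x : 'M[k]_(q, \sum_(i < 3) m)) (U : 'M[k]_m) :
  (x <= \mxdiag_(i < 3) U)%MS <-> (forall i : 'I_3, (submxrow x i <= U)%MS).
Proof.
split=> [/submxP[D ->] i|s].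
  rewrite -[D]submxrowK mul_mxrow_mxdiag mxrowK; exact: submxMl.
rewrite -[x]submxrowK.
have -> : \mxrow_j submxrow x j
   = (\mxrow_(j < 3) (submxrow x j *m pinvmx U)) *m \mxdiag_(i < 3) U.
  by rewrite mul_mxrow_mxdiag; apply/eq_mxrowP => i; rewrite mulmxKpV.
exact: submxMl.
Qed.

(** The relation between [B] and [A] gives one inclusion; the dimension count in [refl] makes it an
    equality. *)
Lemma refl_eqmx l m n (A : arrows m n) (B : arrows l m) :
  refl A B -> (\mxrow_i B i :=: kermx (\mxcol_i A i))%MS.
Proof.
case=> fA fB BA d; apply/eqmxP/andP.
have s : (\mxrow_i B i <= kermx (\mxcol_i A i))%MS.
  by apply/sub_kermxP; rewrite mul_mxrow_mxcol.
split=> //; rewrite -(mxrank_leqif_sup s) mxrank_ker.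
move: fA fB; rewrite /row_full /row_free => /eqP -> /eqP ->.
rewrite sum_nat_const card_ord; lia.
Qed.

(** Rank-nullity for the map U (x) k^3 -> k^n given by the arrows of [A]: its image is [gen A U],
    and by exactness its kernel is the image of [pre B U]. Thus [(pre B U, U)] is numerically the
    reflection of [(U, gen A U)]. *)
Lemma rank_pre_gen l m n (A : arrows m n) (B : arrows l m) (U : 'M_m) :
  refl A B -> (\rank (pre B U) + \rank (gen A U) = 3 * \rank U)%N.
Proof.
move=> r; have e := refl_eqmx r; case: r => fA fB BA d.
pose D := \mxdiag_(i < 3) U.
have rD : \rank D = (3 * \rank U)%N.
  by rewrite rank_mxdiag sum_nat_const card_ord.
rewrite -rD -(mxrank_mul_ker D (\mxcol_i A i)) addnC; congr (_ + _)%N.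
  by rewrite mul_mxdiag_mxcol eqmx_col.
rewrite -(mxrankMfree (pre B U) fB).
apply: eqmx_rank; apply/rV_eqP => u.
rewrite sub_capmx -e; apply/idP/andP => [|[uD /submxP[x ux]]].
  case/submxP=> x ->; split; last exact: mulmx_sub (submxMl _ _).
  apply/sub_mxdiagP => i; rewrite mulmxA mul_mxrow mxrowK.
  have /sub_preP/(_ i) // : (x *m pre B U <= pre B U)%MS by exact: submxMl.
rewrite ux; apply: submxMr; apply/sub_preP => i.
by move/sub_mxdiagP: uD => /(_ i); rewrite ux mul_mxrow mxrowK.
Qed.

Lemma is_sub_cap m n (A : arrows m n) U1 U2 V1 V2 :
  is_sub A U1 U2 -> is_sub A V1 V2 -> is_sub A (U1 :&: V1)%MS (U2 :&: V2)%MS.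
Proof.
move=> sU sV i; rewrite sub_capmx.
by rewrite (submx_trans (submxMr _ (capmxSl _ _)) (sU i))
           (submx_trans (submxMr _ (capmxSr _ _)) (sV i)).
Qed.

Lemma is_sub_add m n (A : arrows m n) U1 U2 V1 V2 :
  is_sub A U1 U2 -> is_sub A V1 V2 -> is_sub A (U1 + V1)%MS (U2 + V2)%MS.
Proof. by move=> sU sV i; rewrite addsmxMr addsmxS ?sU ?sV. Qed.

Lemma is_sub0 m n (A : arrows m n) : is_sub A 0 0.
Proof. by move=> i; rewrite mul0mx sub0mx. Qed.

Lemma is_sub1 m n (A : arrows m n) U1 : is_sub A U1 1%:M.
Proof. by move=> i; rewrite submx1. Qed.

(** A basis of the kernel of k^m (x) k^3 -> k^n, cut into three blocks, provides the new arrows. *)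
Lemma refl_exists m n (A : arrows m n) : row_full (\mxcol_i A i) ->
  exists l (B : arrows l m), refl A B.
Proof.
move=> fA; pose K := kermx (\mxcol_i A i).
exists (\rank K), (fun i => submxrow (row_base K) i); split=> //.
- by rewrite submxrowK row_base_free.
- rewrite -mul_mxrow_mxcol submxrowK; apply/eqP; rewrite -sub_kermx.
  by rewrite eq_row_base.
rewrite mxrank_ker (eqP fA) sum_nat_const card_ord.
have := rank_leq_row (\mxcol_i A i); rewrite (eqP fA) sum_nat_const card_ord.
lia.
Qed.

Lemma dualK m n (A : arrows m n) : dual (dual A) = A.
Proof. by apply/funext => i; rewrite /dual trmxK. Qed.

Lemma dual_refl l m n (A : arrows m n) (B : arrows l m) :
  refl A B -> refl (dual B) (dual A).
Proof.
case=> fA fB BA d; split; last lia.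
- rewrite /row_full /dual -tr_mxrow mxrank_tr; exact: fB.
- rewrite /row_free /dual -tr_mxcol mxrank_tr; exact: fA.
transitivity ((\sum_i B i *m A i)^T); last by rewrite BA trmx0.
rewrite (raddf_sum (@trmx k l n)); apply: eq_bigr => i _. by rewrite /dual /= trmx_mul.
Qed.

(** * Annihilators and dual subrepresentations *)

Definition ann m (U : 'M[k]_m) : 'M[k]_m := kermx U^T.

Lemma rank_ann m (U : 'M[k]_m) : \rank (ann U) = (m - \rank U)%N.
Proof. by rewrite mxrank_ker mxrank_tr. Qed.

Lemma annS m (U V : 'M[k]_m) : (U <= V)%MS -> (ann V <= ann U)%MS.
Proof.
case/submxP => D ->; apply/sub_kermxP; rewrite trmx_mul mulmxA.
by rewrite mulmx_ker mul0mx.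
Qed.

Lemma ann_ann m (U : 'M[k]_m) : (ann (ann U) :=: U)%MS.
Proof.
apply/eqmxP/andP.
have s : (U <= ann (ann U))%MS.
  apply/sub_kermxP; apply: trmx_inj; rewrite trmx_mul trmxK trmx0.
  exact: mulmx_ker.
split=> //; rewrite -(mxrank_leqif_sup s) !rank_ann.
by have := rank_leq_row U; lia.
Qed.

Lemma le_annC m (U V : 'M[k]_m) : (U <= ann V)%MS -> (V <= ann U)%MS.
Proof. by move/annS; apply: submx_trans; rewrite ann_ann. Qed.

Lemma ann_leC m (U V : 'M[k]_m) : (ann V <= U)%MS -> (ann U <= V)%MS.
Proof. by move/annS => h; apply: submx_trans h _; rewrite ann_ann. Qed.

(** The pair of annihilators is the dual of the quotient by [(U1, U2)], embedded in the dual
    representation. *)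
Lemma is_sub_ann m n (A : arrows m n) U1 U2 :
  is_sub A U1 U2 -> is_sub (dual A) (ann U2) (ann U1).
Proof.
move=> s i; apply/sub_kermxP; have /submxP[D e] := s i.
by rewrite /dual -mulmxA -trmx_mul e trmx_mul mulmxA mulmx_ker mul0mx.
Qed.

Lemma is_sub_dual m n (A : arrows m n) U1 U2 :
  is_sub (dual A) U1 U2 -> is_sub A (ann U2) (ann U1).
Proof. by move/is_sub_ann; rewrite dualK. Qed.

Lemma is_sub_le_gen m n (A : arrows m n) U1 (U2 : 'M_n) : is_sub A U1 U2 ->
  (\rank (gen A U1) <= \rank U2)%N.
Proof. by move=> s; apply: mxrankS; apply/gen_subP. Qed.

Lemma is_sub_le_pre l m (B : arrows l m) U1 (U2 : 'M_m) : is_sub B U1 U2 ->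
  (\rank U1 <= \rank (pre B U2))%N.
Proof. by move=> s; apply: mxrankS; apply/sub_preP. Qed.

End Subreps.

(** * Stability with respect to the weight lam *)

(** Subrepresentations may be infinite in number, but their dimension vectors lie in a finite grid,
    so a weight attains its maximum on them. *)
Lemma ex_max (R : realDomainType) (P : nat -> nat -> Prop) (N : nat)
    (f : nat -> nat -> R) :
  (forall a b, P a b -> (a <= N)%N /\ (b <= N)%N) -> (exists a b, P a b) ->
  exists a b, P a b /\ forall a' b', P a' b' -> f a' b' <= f a b.
Proof.
move=> bP [a [b Pab]].
pose Q (d : 'I_N.+1 * 'I_N.+1) := `[< P d.1 d.2 >].
have [ha hb] := bP _ _ Pab.
have Q0 : Q (inord a, inord b) by apply/asboolP; rewrite /= !inordK.
case: (@Order.TotalTheory.arg_maxP _ _ _ (inord a, inord b) Q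
  (fun d => f d.1 d.2) Q0) => d /asboolP Pd dmax.
exists d.1, d.2; split=> // a' b' P'; have [ha' hb'] := bP _ _ P'.
have /dmax /= : Q (inord a', inord b') by apply/asboolP; rewrite /= !inordK.
by rewrite !inordK.
Qed.

(* lam is extracted from an opaque proof so that nothing ever computes with it. *)
Lemma lam_exists :
  {R : realFieldType & {lam : R | lam * lam = 3 * lam - 1 & 5 / 2 < lam}}.
Proof.
exists realalg; exists ((3 + Num.sqrt 5) / 2 : realalg).
  have : Num.sqrt (5 : realalg) ^+ 2 = 5 by rewrite sqr_sqrtr.
  by rewrite expr2; move: (Num.sqrt _) => s; lra.
have : Num.sqrt (4 : realalg) < Num.sqrt 5 by rewrite ltr_sqrt; lra.
rewrite (_ : 4 = 2 ^+ 2); last by rewrite expr2; ring.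
by rewrite sqrtr_sqr ger0_norm; [move: (Num.sqrt _) => s; lra | lra].
Qed.

Definition R : realFieldType := projT1 lam_exists.
Definition lam : R := s2val (projT2 lam_exists).

Lemma lam_sq : lam * lam = 3 * lam - 1. Proof. exact: (s2valP (projT2 lam_exists)). Qed.

Lemma lam_gt : 5 / 2 < lam. Proof. exact: (s2valP' (projT2 lam_exists)). Qed.

Lemma lam_lt3 : lam < 3. Proof. move: lam_sq lam_gt; nra. Qed.

Section Stability.
Variable k : fieldType.
Implicit Types m n l : nat.

(* For a dimension vector (a, b), th a b > 0 means b / a < lam, and
   th b a > 0 means b / a > 1 / lam. *)
Definition th (a b : nat) : R := lam * a%:R - b%:R.

(* tors bounds the slopes of all quotients by lam (no preprojective quotient);
   cotors bounds the slopes of all subrepresentations below by 1 / lam. *)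
Definition tors m n (A : arrows k m n) := forall U1 U2, is_sub A U1 U2 ->
  th (\rank U1) (\rank U2) <= th m n.

Definition cotors m n (A : arrows k m n) := forall U1 U2, is_sub A U1 U2 ->
  0 <= th (\rank U2) (\rank U1).

(* The last two conditions say that V is in the torsion class and that the
   quotient by V is in the torsion-free class; for regular A this makes both
   of them regular. *)
Definition splits m n (A : arrows k m n) (V1 : 'M_m) (V2 : 'M_n) :=
  [/\ is_sub A V1 V2, (0 < \rank V1 + \rank V2 < m + n)%N,
      forall U1 U2, is_sub A U1 U2 -> (U1 <= V1)%MS -> (U2 <= V2)%MS ->
        th (\rank U1) (\rank U2) <= th (\rank V1) (\rank V2)
    & forall U1 U2, is_sub A U1 U2 -> (V1 <= U1)%MS -> (V2 <= U2)%MS ->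
        th (\rank V2) (\rank V1) <= th (\rank U2) (\rank U1)].

(** Numerical form of [elementary]; the two are matched in [elementaryP]. *)
Definition elem m n (A : arrows k m n) :=
  [/\ (0 < m + n)%N, tors A, cotors A & ~ exists V1 V2, splits A V1 V2].

Lemma thD a b c d : th (a + b) (c + d) = th a c + th b d.
Proof. by rewrite /th !natrD; ring. Qed.

(** The two weights are eigenvectors of the reflection on dimension vectors, with eigenvalues [lam]
    here and [3 - lam = 1 / lam] in [th_refl']. *)
Lemma th_refl (a b c : nat) : (a + b = 3 * c)%N -> th a c = lam * th c b.
Proof.
move=> /(congr1 (fun x => x%:R : R)); rewrite natrD natrM /th => e.
have -> : a%:R = 3 * c%:R - b%:R :> R by rewrite -e; ring.
have -> : lam * (lam * c%:R - b%:R) = lam * lam * c%:R - lam * b%:R by ring.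
by rewrite lam_sq; ring.
Qed.

Lemma th_refl' (a b c : nat) : (a + b = 3 * c)%N -> th c a = (3 - lam) * th b c.
Proof.
move=> /(congr1 (fun x => x%:R : R)); rewrite natrD natrM /th => e.
have -> : a%:R = 3 * c%:R - b%:R :> R by rewrite -e; ring.
have -> : (3 - lam) * (lam * b%:R - c%:R) = 3 * lam * b%:R - lam * lam * b%:R
  - 3 * c%:R + lam * c%:R by ring.
by rewrite lam_sq; ring.
Qed.

(* Harder-Narasimhan: R1, R2 maximizes th inside U, then V minimizes the dual
   weight above it; both extremal choices give the two halves of splits, and
   the modular law transports the first one from R1, R2 to V. *)
Lemma splits_of_sub m n (A : arrows k m n) U1 U2 : is_sub A U1 U2 ->
  0 < th (\rank U1) (\rank U2) -> th (\rank U2) (\rank U1) < th n m ->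
  exists V1 V2, splits A V1 V2.
Proof.
move=> sU Upos Ult.
have bm (X : 'M[k]_m) : (\rank X <= m + n)%N.
  by rewrite (leq_trans (rank_leq_row _)) // leq_addr.
have bn (X : 'M[k]_n) : (\rank X <= m + n)%N.
  by rewrite (leq_trans (rank_leq_row _)) // leq_addl.
pose P a b := exists R1 R2, [/\ is_sub A R1 R2, (R1 <= U1)%MS, (R2 <= U2)%MS,
  \rank R1 = a & \rank R2 = b].
have [||ra [rb [[R1 [R2 [sR R1U R2U ea eb]]] Rmax]]] :=
  @ex_max R P (m + n)%N th; first by move=> a b [? [? [_ _ _ <- <-]]].
  by exists (\rank U1), (\rank U2), U1, U2.
pose P' a b := exists V1 V2, [/\ is_sub A V1 V2, (R1 <= V1)%MS, (R2 <= V2)%MS,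
  \rank V1 = a & \rank V2 = b].
have [||va [vb [[V1 [V2 [sV RV1 RV2 eva evb]]] Vmin]]] :=
  @ex_max R P' (m + n)%N (fun a b => - th b a).
- by move=> a b [? [? [_ _ _ <- <-]]].
- by exists (\rank R1), (\rank R2), R1, R2.
subst ra rb va vb.
have thR : 0 < th (\rank R1) (\rank R2).
  by apply: lt_le_trans Upos _; apply: Rmax; exists U1, U2.
have thV : th (\rank V2) (\rank V1) < th n m.
  have : P' (\rank U1) (\rank U2) by exists U1, U2.
  by move/Vmin; move: Ult; lra.
exists V1, V2; split=> //.
(* [V] is nonzero because it contains [R1], [R2] of positive weight, and proper because its dual
   weight is below that of the whole. *)
- apply/andP; split.
    rewrite lt0n; apply/eqP => e0; move: thR.
    have := mxrankS RV1; have := mxrankS RV2; rewrite /th.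
    have -> : \rank V1 = 0%N by lia.
    have -> : \rank V2 = 0%N by lia.
    by rewrite !leqn0 => /eqP -> /eqP ->; lra.
  rewrite ltn_neqAle leq_add ?rank_leq_row // andbT; apply/eqP => e.
  have := rank_leq_row V1; have := rank_leq_row V2 => h1 h2.
  have e1 : \rank V1 = m by lia.
  have e2 : \rank V2 = n by lia.
  by move: thV; rewrite e1 e2 ltxx.
- move=> W1 W2 sW WV1 WV2.
  have /Rmax h1 : P (\rank (W1 :&: R1)%MS) (\rank (W2 :&: R2)%MS).
    exists (W1 :&: R1)%MS, (W2 :&: R2)%MS; split=> //; first exact: is_sub_cap.
      exact: submx_trans (capmxSr _ _) _.
    exact: submx_trans (capmxSr _ _) _.
  have /Vmin h2 : P' (\rank (W1 + R1)%MS) (\rank (W2 + R2)%MS).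
    exists (W1 + R1)%MS, (W2 + R2)%MS; split=> //; first exact: is_sub_add.
      exact: addsmxSr.
    exact: addsmxSr.
  have e : th (\rank W1) (\rank W2) + th (\rank R1) (\rank R2) =
    th (\rank (W1 + R1)%MS) (\rank (W2 + R2)%MS)
    + th (\rank (W1 :&: R1)%MS) (\rank (W2 :&: R2)%MS).
    by rewrite -!thD !mxrank_sum_cap.
  have k1 : (\rank (W1 + R1)%MS <= \rank V1)%N.
    by apply: mxrankS; rewrite addsmx_sub WV1.
  have k2 : (\rank (W2 + R2)%MS <= \rank V2)%N.
    by apply: mxrankS; rewrite addsmx_sub WV2.
  (* Let (d1, d2) be the dimension vector of V / (W + R). Minimality of [V] gives lam d2 <= d1,
     hence d2 <= lam d1, so passing from W + R to V does not lower [th]. *)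
  move: h1 h2 e k1 k2; rewrite -!(ler_nat R) /th => h1 h2 e k1 k2.
  by move: lam_sq lam_gt lam_lt3 => t1 t2 t3; nra.
move=> W1 W2 sW VW1 VW2; rewrite -lerN2; apply: Vmin.
by exists W1, W2; split=> //; [exact: submx_trans VW1|exact: submx_trans VW2].
Qed.

(** * Invariance under reflections *)

Section Reflection.
Variables (l m n : nat) (A : arrows k m n) (B : arrows k l m).
Hypothesis rAB : refl A B.

Let dimAB : (l + n = 3 * m)%N. Proof. by case: rAB. Qed.

Lemma th_pre_gen (U : 'M_m) :
  th (\rank (pre B U)) (\rank U) = lam * th (\rank U) (\rank (gen A U)) /\
  th (\rank U) (\rank (pre B U)) = (3 - lam) * th (\rank (gen A U)) (\rank U).
Proof. by have e := rank_pre_gen U rAB; rewrite (th_refl e) (th_refl' e). Qed.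

(** Replacing [W1] by [pre B W2] only raises the weight, and the enlarged pair is the reflection of
    [(W2, gen A W2)], where the hypothesis on [A] applies. The proof of [cotors_refl] is
    parallel. *)
Lemma tors_refl : tors A -> tors B.
Proof.
move=> TA W1 W2 sW; rewrite (th_refl dimAB).
have h : th (\rank W1) (\rank W2) <= th (\rank (pre B W2)) (\rank W2).
  have := is_sub_le_pre sW; rewrite -(ler_nat R) /th.
  by move: lam_gt => t2; nra.
apply: le_trans h _; rewrite (th_pre_gen W2).1.
have := TA _ _ (is_sub_gen A W2); move: lam_gt; nra.
Qed.

Lemma cotors_refl : cotors A -> cotors B.
Proof.
move=> FA W1 W2 sW.
have h : th (\rank W2) (\rank (pre B W2)) <= th (\rank W2) (\rank W1).
  have := is_sub_le_pre sW; rewrite -(ler_nat R) /th.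
  by move: lam_gt => t2; nra.
apply: le_trans h; rewrite (th_pre_gen W2).2.
have := FA _ _ (is_sub_gen A W2); move: lam_lt3; nra.
Qed.

(* The descent step used to show that a representation outside the torsion
   class becomes simple projective after finitely many reflections. *)
Lemma not_tors_refl U1 (U2 : 'M_n) : is_sub A U1 U2 ->
  th m n < th (\rank U1) (\rank U2) ->
  [/\ is_sub B (pre B U1) U1, th l m < th (\rank (pre B U1)) (\rank U1)
    & (l - \rank (pre B U1) < m - \rank U1)%N].
Proof.
move=> sU lt; have h := is_sub_le_gen sU; have r1 := rank_leq_row U1.
have lt' : th m n < th (\rank U1) (\rank (gen A U1)).
  by move: h lt; rewrite -(ler_nat R) /th; lra.
split; first exact: is_sub_pre.
  by rewrite (th_refl dimAB) (th_pre_gen U1).1; move: lam_gt; nra.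
have e := rank_pre_gen U1 rAB; have r3 := rank_leq_row (pre B U1).
(* The quotient by [(U1, gen A U1)] has slope above [lam], hence above 2, so the first dimension of
   its reflection is smaller than its own. *)
have : lam * (m - \rank U1)%:R < (n - \rank (gen A U1))%:R :> R.
  have := rank_leq_row (gen A U1) => r4.
  by rewrite !natrB //; move: lt'; rewrite /th; lra.
move=> q; suff : (2 * (m - \rank U1) < n - \rank (gen A U1))%N by lia.
rewrite -(ltr_nat R) natrM; apply: le_lt_trans q.
by apply: ler_wpM2r => //; move: lam_gt; lra.
Qed.

(** A splitting pair of [B] is itself a reflection, namely that of [(V2, gen A V2)]; both extremal
    conditions then transport because the weights are multiplied by positive constants. *)
Lemma splits_refl V1 V2 : splits B V1 V2 -> exists W1 W2, splits A W1 W2.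
Proof.
case=> sV /andP[V0 Vlt] VT VF; exists V2, (gen A V2).
have e := rank_pre_gen V2 rAB.
have V1pre : (V1 <= pre B V2)%MS by apply/sub_preP.
(* Enlarging [V1] to [pre B V2] cannot lower the dual weight, which decreases with the first
   dimension, so nothing is gained. *)
have er : \rank V1 = \rank (pre B V2).
  apply/eqP; rewrite eqn_leq mxrankS //=.
  have := VF _ _ (is_sub_pre B V2) V1pre (submx_refl _).
  by rewrite /th -(ler_nat R); lra.
have preV1 : (pre B V2 <= V1)%MS by rewrite -(mxrank_leqif_sup V1pre) er.
split.
- exact: is_sub_gen.
- apply/andP; split.
    by lia.
  have := rank_leq_row V1; have := rank_leq_row V2.
  have := rank_leq_row (gen A V2); lia.
- move=> U1 U2 sU U1V _.
  have h := is_sub_le_gen sU.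
  have := VT _ _ (is_sub_pre B U1) (submx_trans (preS B U1V) preV1) U1V.
  rewrite (th_pre_gen U1).1 er (th_pre_gen V2).1 ler_pM2l; last first.
    by move: lam_gt; lra.
  by move: h; rewrite -(ler_nat R) /th; lra.
move=> U1 U2 sU VU1 _; have h := is_sub_le_gen sU.
have := VF _ _ (is_sub_pre B U1) (submx_trans V1pre (preS B VU1)) VU1.
rewrite (th_pre_gen U1).2 er (th_pre_gen V2).2 ler_pM2l; last first.
  by rewrite subr_gt0 lam_lt3.
by move: h; rewrite -(ler_nat R) /th; move: lam_gt; nra.
Qed.

Lemma elem_refl : elem A -> elem B.
Proof.
case=> mn TA FA nS; split; [lia|exact: tors_refl|exact: cotors_refl|].
by case=> V1 [V2 /splits_refl].
Qed.

End Reflection.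

(** The subrepresentation generated by the whole first space already has maximal weight only if it
    is everything. This makes a reflection available. *)
Lemma tors_row_full m n (A : arrows k m n) : tors A -> row_full (\mxcol_i A i).
Proof.
move=> TA; have s : is_sub A 1%:M (gen A 1%:M) by exact: is_sub_gen.
have := TA _ _ s; rewrite mxrank1 /th => h.
have : (n <= \rank (gen A 1%:M))%N by rewrite -(ler_nat R); lra.
rewrite -col_leq_rank eqmx_col /gen.
by under eq_bigr do rewrite mul1mx.
Qed.

(** * Invariance under duality *)

Lemma th_ann m n (U1 : 'M[k]_m) (U2 : 'M[k]_n) :
  th (\rank (ann U1)) (\rank (ann U2)) = th m n - th (\rank U1) (\rank U2).
Proof. by rewrite !rank_ann /th !natrB ?rank_leq_row //; ring. Qed.

Lemma dual_tors m n (A : arrows k m n) : cotors A -> tors (dual A).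
Proof. by move=> FA U1 U2 /is_sub_dual /FA; rewrite th_ann; lra. Qed.

Lemma dual_cotors m n (A : arrows k m n) : tors A -> cotors (dual A).
Proof. by move=> TA U1 U2 /is_sub_dual /TA; rewrite th_ann; lra. Qed.

Lemma elem_dual m n (A : arrows k m n) : elem A -> elem (dual A).
Proof.
case=> mn TA FA nS; split; [lia|exact: dual_tors|exact: dual_cotors|].
case=> V1 [V2 [sV Vn VT VF]]; apply: nS; exists (ann V2), (ann V1); split.
- exact: is_sub_dual.
- rewrite !rank_ann; have := rank_leq_row V1; have := rank_leq_row V2; lia.
- move=> U1 U2 sU h1 h2.
  have := VF _ _ (is_sub_ann sU) (le_annC h2) (le_annC h1).
  by rewrite (th_ann U1 U2) (th_ann V2 V1); lra.
move=> U1 U2 sU h1 h2.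
have := VT _ _ (is_sub_ann sU) (ann_leC h2) (ann_leC h1).
by rewrite (th_ann U2 U1) (th_ann V1 V2); lra.
Qed.

End Stability.

(** * Pencils and nets of matrices *)

Section Theta.
Variable K : comNzRingType.

(* Theta F G applied to (g0, g1, g2) lists the coefficients of
   (g0 + g1 s + g2 s^2) (F + s G). *)
Definition Theta p q (F G : 'M[K]_(p, q)) :
    'M[K]_(p + (p + p), q + (q + (q + q))) :=
  col_mx (row_mx F (row_mx G (row_mx 0 0)))
 (col_mx (row_mx 0 (row_mx F (row_mx G 0)))
         (row_mx 0 (row_mx 0 (row_mx F G)))).

(** Gradings by powers of s on the rows and columns of [Theta]; they express that rescaling [F]
    amounts to rescaling s. *)
Definition diag3 p (r : K) : 'M[K]_(p + (p + p)) :=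
  block_mx r%:M 0 0 (block_mx (r ^+ 2)%:M 0 0 (r ^+ 3)%:M).
Definition diag4 q (r : K) : 'M[K]_(q + (q + (q + q))) :=
  block_mx 1%:M 0 0 (block_mx r%:M 0 0 (block_mx (r ^+ 2)%:M 0 0 (r ^+ 3)%:M)).

Lemma Theta_scale p q r (F G : 'M[K]_(p, q)) :
  Theta (r *: F) G *m diag4 q r = diag3 p r *m Theta F G.
Proof.
rewrite /Theta /diag3 /diag4 !mul_block_col !mul_col_mx.
do 8![rewrite ?(mulmx0, mul0mx, addr0, add0r, mul_block_col, mul_row_block,
  mul_mx_scalar, mul_scalar_mx, scale1r)].
rewrite ?(scale_row_mx, scaler0, scalerA).
by rewrite -exprSr -expr2.
Qed.

Lemma det_diag3 p r : \det (diag3 p r) = r ^+ (6 * p).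
Proof.
rewrite /diag3 !det_ublock !det_scalar -!exprM -!exprD; congr (_ ^+ _); lia.
Qed.

Lemma det_diag4 q r : \det (diag4 q r) = r ^+ (6 * q).
Proof.
rewrite /diag4 !det_ublock !det_scalar -!exprM expr1n mul1r -!exprD.
congr (_ ^+ _); lia.
Qed.

(** The system is square since 4 * 3 = 3 * 4 = 12. The lock prevents the determinant from being
    unfolded. *)
Definition detTheta (F G : 'M[K]_(4, 3)) : K := locked (\det (Theta F G : 'M_12)).

Lemma detTheta_scale r F G :
  detTheta (r *: F) G * r ^+ 18 = r ^+ 24 * detTheta F G.
Proof.
rewrite -[r ^+ 18](det_diag4 3) -[r ^+ 24](det_diag3 4) /detTheta -!lock.
by rewrite -[LHS]det_mulmx -[RHS]det_mulmx (Theta_scale r F G).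
Qed.

End Theta.

Lemma map_Theta (K L : comNzRingType) (f : {rmorphism K -> L}) p q
    (F G : 'M[K]_(p, q)) :
  map_mx f (Theta F G) = Theta (map_mx f F) (map_mx f G).
Proof. by rewrite /Theta !(map_col_mx, map_row_mx) !map_mx0. Qed.

Lemma map_detTheta (K L : comNzRingType) (f : {rmorphism K -> L}) F G :
  f (detTheta F G) = detTheta (map_mx f F) (map_mx f G).
Proof.
rewrite /detTheta -!lock -det_map_mx; congr (\det _); refine (@map_Theta K L f 4 3 F G).
Qed.

Lemma horner_detTheta (K : comNzRingType) (x : K) F G :
  (detTheta F G).[x] =
  detTheta (map_mx (fun p => p.[x]) F) (map_mx (fun p => p.[x]) G).
Proof. exact: (map_detTheta (horner_eval x) F G). Qed.

Section Pencils.
Variable k : closedFieldType.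

(** If [X] has a left kernel it serves alone; otherwise [X] is invertible and an eigenvector of
    [Y *m invmx X] works. *)
Lemma pencil_kernel p q (X Y : 'M[k]_(p, q)) : (0 < p)%N -> (q <= p)%N ->
  exists a b (v : 'rV_p),
    [/\ (a != 0) || (b != 0), v != 0 & v *m (a *: X + b *: Y) = 0].
Proof.
move=> p0; rewrite leq_eqVlt => /orP[/eqP e|lt]; last first.
  have : kermx X != 0.
    by rewrite -mxrank_eq0 mxrank_ker; have := rank_leq_col X; lia.
  case/rowV0Pn => v /sub_kermxP vX v0; exists 1, 0, v; split=> //.
    by rewrite oner_neq0.
  by rewrite scale1r scale0r addr0.
subst q; case: (boolP (X \in unitmx)) => [uX|nX]; last first.
  have : kermx X != 0.
    rewrite -mxrank_eq0 mxrank_ker; move: nX.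
    by rewrite -row_free_unit /row_free; have := rank_leq_col X; lia.
  case/rowV0Pn => v /sub_kermxP vX v0; exists 1, 0, v; split=> //.
    by rewrite oner_neq0.
  by rewrite scale1r scale0r addr0.
have /closed_rootP[x] : size (char_poly (Y *m invmx X)) != 1%N.
  by rewrite size_char_poly; lia.
rewrite -eigenvalue_root_char => /eigenvalueP[v ev v0].
exists (- x), 1, v; split=> //; first by rewrite oner_neq0 orbT.
rewrite scale1r scaleNr mulmxDr mulmxN -scalemxAr addrC.
have := congr1 (mulmx^~ X) ev; rewrite /= mulmxA mulmxKV // => ->.
by rewrite -scalemxAl subrr.
Qed.

(* The span W of the g_i satisfies W G <= W F with dim (W F) < dim W, so the
   pencil induced on the quotients k^4 / W and k^3 / (W F) has a nonsurjective
   member. *)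
Lemma pencil_drop (F G : 'M[k]_(4, 3)) (g0 g1 g2 : 'rV_4) :
  g0 *m F = 0 -> g0 *m G + g1 *m F = 0 -> g1 *m G + g2 *m F = 0 ->
  g2 *m G = 0 -> [|| g0 != 0, g1 != 0 | g2 != 0] ->
  exists a b (s : 'rV_3),
    [/\ (a != 0) || (b != 0), s != 0 & (a *: F + b *: G) *m s^T = 0].
Proof.
move=> e0 e1 e2 e3 nz.
pose W := (g0 + (g1 + g2))%MS.
have g0W : (g0 <= W)%MS by rewrite addsmxSl.
have g1W : (g1 <= W)%MS by rewrite (submx_trans (addsmxSl _ g2)) ?addsmxSr.
have g2W : (g2 <= W)%MS by rewrite (submx_trans (addsmxSr g1 _)) ?addsmxSr.
have WG : (W *m G <= W *m F)%MS.
  have sF (g h : 'rV_4) : (h <= W)%MS -> g *m G + h *m F = 0 ->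
      (g *m G <= W *m F)%MS.
    move=> hW /eqP; rewrite addr_eq0 => /eqP ->; rewrite -mulNmx.
    by apply: submxMr; rewrite eqmx_opp.
  move: (W *m F)%R (sF) => Z sZ.
  rewrite addsmxMr addsmx_sub (sZ _ g1) // addsmxMr addsmx_sub (sZ _ g2) //.
  by rewrite e3 sub0mx.
have [g [gW g00 gF]] : exists g : 'rV_4, [/\ (g <= W)%MS, g != 0 & g *m F = 0].
  case: (eqVneq g0 0) e1 nz => [-> | g00 _ _]; last by exists g0.
  rewrite mul0mx add0r /= => e1.
  case: (eqVneq g1 0) e2 => [-> | g10 _ _]; last by exists g1.
  by rewrite mul0mx add0r /= => e2 g20; exists g2.
have rW : (\rank (W *m F) < \rank W)%N.
  have := mxrank_mul_ker W F.
  have : (\rank g <= \rank (W :&: kermx F)%MS)%N.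
    by apply: mxrankS; rewrite sub_capmx gW; apply/sub_kermxP.
  by rewrite rank_rV g00; lia.
have rW3 : (\rank W <= 3)%N.
  have := (mxrank_adds_leqif g0 (g1 + g2)%MS).1.
  have := (mxrank_adds_leqif g1 g2).1.
  have := rank_leq_row g0; have := rank_leq_row g1; have := rank_leq_row g2.
  by rewrite /W; lia.
(* The rows of [S] and [N] are bases of the functionals vanishing on W F and on W. The matrices [X],
   [Y] below are the transposes of the maps k^4 / W -> k^3 / (W F) induced by [F] and [G]; they have
   at least as many rows as columns because [W *m F] has smaller rank than [W]. *)
pose S := row_base (kermx (W *m F)^T); pose N := row_base (kermx W^T).
have NE := eq_row_base (kermx W^T).
have SE := eq_row_base (kermx (W *m F)^T).
have subN (H : 'M_(4, 3)) : (W *m H <= W *m F)%MS -> (S *m H^T <= N)%MS.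
  case/submxP => D eD; rewrite NE; apply/sub_kermxP.
  rewrite -mulmxA -trmx_mul eD [(D *m _)^T]trmx_mul mulmxA.
  suff -> : S *m (W *m F)^T = 0 by rewrite mul0mx.
  by apply/sub_kermxP; rewrite SE.
have /submxP[X eX] := subN _ (submx_refl _); have /submxP[Y eY] := subN _ WG.
have [||a [b [v [ab v0 ev]]]] := pencil_kernel X Y.
- by rewrite mxrank_ker mxrank_tr; lia.
- by rewrite !mxrank_ker !mxrank_tr; lia.
exists a, b, (v *m S); split=> //.
  by rewrite mulmx_free_eq0 ?row_base_free.
apply: trmx_inj; rewrite trmx_mul trmxK trmx0 linearD /= !linearZ /=.
rewrite -mulmxA mulmxDr -!scalemxAr eX eY !scalemxAl -mulmxDl mulmxA.
by rewrite ev mul0mx.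
Qed.

(** Otherwise ['X * S + 1] would be nonconstant without a root: it takes the value 1 everywhere. *)
Lemma poly_root_nz (S : {poly k}) : (forall x, x != 0 -> S.[x] = 0) -> S = 0.
Proof.
move=> S0; apply/eqP; apply/negPn/negP => Sn0.
have : size ('X * S + 1) != 1%N.
  have sz : size ('X * S) = (size S).+1 by rewrite mulrC size_mulX.
  by rewrite size_polyDl ?size_poly1 sz ?ltnS ?lt0n ?eqSS size_poly_eq0.
case/closed_rootP => x; rewrite /root hornerD hornerM hornerX hornerC.
case: (eqVneq x 0) => [->|/S0 ->].
  by rewrite mul0r add0r oner_eq0.
by rewrite mulr0 add0r oner_eq0.
Qed.

(* det (Theta F C) is homogeneous of degree 6 in F, hence vanishes
   somewhere on the projective line of x B - y A. *)
Lemma detTheta_zero (A B C : 'M[k]_(4, 3)) :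
  exists x y, ((x != 0) || (y != 0)) /\ detTheta (x *: B - y *: A) C = 0.
Proof.
pose P := detTheta ('X *: map_mx polyC B - map_mx polyC A) (map_mx polyC C).
have PE x : P.[x] = detTheta (x *: B - A) C.
  rewrite /P; apply: etrans (horner_detTheta _ _ _) _.
  apply: f_equal2; apply/matrixP => i j; by rewrite !mxE !hornerE.
pose Q := detTheta (map_mx polyC B - 'X *: map_mx polyC A) (map_mx polyC C).
have QE x : Q.[x] = detTheta (B - x *: A) C.
  rewrite /Q; apply: etrans (horner_detTheta _ _ _) _.
  apply: f_equal2; apply/matrixP => i j; by rewrite !mxE !hornerE.
case: (boolP (size P == 1%N)) => [/size_poly1P[c c0 Pc]|]; last first.
  move/closed_rootP => [x /rootP rx]; exists x, 1; rewrite oner_neq0 orbT.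
  by rewrite scale1r -PE.
(* With [P] a nonzero constant c, the zero lies at infinity: by homogeneity Q(x) = c x^6 away from
   0, hence also at 0. *)
exists 1, 0; rewrite oner_neq0; split=> //.
rewrite scale0r subr0 scale1r.
suff : Q.[0] = 0 by rewrite QE scale0r subr0.
have Qx x : x != 0 -> Q.[x] = c * x ^+ 6.
  move=> x0; have := detTheta_scale x (x^-1 *: B - A) C.
  rewrite -PE Pc hornerC scalerBr scalerA (mulfV x0) scale1r -QE.
  rewrite (exprD x 6 18) => e.
  have x18 : x ^+ 18 != 0 by rewrite expf_neq0.
  by apply: (mulIf x18); rewrite e mulrC mulrA.
pose S := Q - c *: 'X^6.
have S0 x : x != 0 -> S.[x] = 0 by move=> x0; rewrite /S hornerD hornerN hornerZ hornerXn (Qx _ x0) subrr.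
have SQ : S.[0] = Q.[0] by rewrite /S hornerD hornerN hornerZ hornerXn expr0n mulr0 subr0.
by rewrite -SQ (poly_root_nz S0) horner0.
Qed.

(** A left kernel vector of [Theta F C], with [F] from [detTheta_zero], gives the three vectors
    required by [pencil_drop]. The pencil member found there lies in the net. *)
Lemma net_drop (A B C : 'M[k]_(4, 3)) : exists a b c (s : 'rV_3),
  [/\ [|| a != 0, b != 0 | c != 0], s != 0 &
      (a *: A + b *: B + c *: C) *m s^T = 0].
Proof.
have [x [y [xy d0]]] := detTheta_zero A B C.
set F := x *: B - y *: A in d0.
move: d0; rewrite /detTheta -lock => /eqP/det0P[g g0 gT].
pose g' : 'rV_(4 + (4 + 4)) := g.
have gT' : g' *m Theta F C = 0 by exact: gT.
have g0' : g' != 0 by exact: g0.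
have eg : g' = row_mx (lsubmx g') (row_mx (lsubmx (rsubmx g')) (rsubmx (rsubmx g'))).
  by rewrite !hsubmxK.
move: eg gT' g0'.
move: (lsubmx g') (lsubmx (rsubmx g')) (rsubmx (rsubmx g')) => h0 h1 h2 ->.
move=> hT h_n0.
have {h_n0} hn0 : [|| h0 != 0, h1 != 0 | h2 != 0].
  apply: contraR h_n0; rewrite !negb_or !negbK => /and3P[/eqP -> /eqP -> /eqP ->].
  by rewrite !row_mx0.
move: hT; rewrite /Theta !mul_row_col !mul_mx_row !mulmx0 !add_row_mx.
rewrite ?add0r ?addr0.
rewrite -row_mx0; case/eq_row_mx => e0; rewrite -row_mx0; case/eq_row_mx => e1.
rewrite -row_mx0; case/eq_row_mx => e2 e3.
have [a [b [s [ab s0 es]]]] := pencil_drop e0 e1 e2 e3 hn0.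
exists (- (a * y)), (a * x), b, s; split=> //.
  apply: contraLR xy; rewrite !negb_or oppr_eq0 !negbK => /and3P[h1' h2' b0].
  have a0 : a != 0 by move: ab; rewrite b0 orbF.
  by move: h1' h2'; rewrite !mulf_eq0 (negPf a0) /= => -> ->.
by rewrite -es /F scalerBr !scalerA scaleNr [- _ + _]addrC.
Qed.

End Pencils.

(** * Small subrepresentations *)

Definition i0 : 'I_3 := @Ordinal 3 0 isT.
Definition i1 : 'I_3 := @Ordinal 3 1 isT.
Definition i2 : 'I_3 := @Ordinal 3 2 isT.

Lemma ord3P (P : 'I_3 -> Prop) : P i0 -> P i1 -> P i2 -> forall i, P i.
Proof.
move=> p0 p1 p2 [[|[|[|//]]] hi].
- by rewrite (_ : Ordinal hi = i0) //; apply: val_inj.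
- by rewrite (_ : Ordinal hi = i1) //; apply: val_inj.
- by rewrite (_ : Ordinal hi = i2) //; apply: val_inj.
Qed.

Section SmallSubs.
Variables (k : closedFieldType).

(** A kernel vector of a combination of two arrows has linearly dependent images under them, so its
    three images span at most a plane. *)
Lemma sub_dim12 m n (A : arrows k m n) : (0 < m)%N -> (n <= m)%N ->
  exists v : 'rV_m, v != 0 /\ (\rank (gen A v) <= 2)%N.
Proof.
move=> m0 nm; have [a [b [v [ab v0 ev]]]] := pencil_kernel (A i0) (A i1) m0 nm.
exists v; split=> //.
suff [j sj] : exists j, (gen A v <= v *m A j + v *m A i2)%MS.
  apply: leq_trans (mxrankS sj) _; have := (mxrank_adds_leqif (v *m A j) (v *m A i2)).1.
  by have := rank_leq_row (v *m A j); have := rank_leq_row (v *m A i2); lia.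
move: ev; rewrite mulmxDr -!scalemxAr => /eqP.
case: (eqVneq b 0) => [b0|b0].
  move: ab; rewrite b0 eqxx orbF => /negPf ab; rewrite scale0r addr0 scaler_eq0 ab /= => /eqP e.
  exists i1; apply/gen_subP; apply: ord3P; first by rewrite e sub0mx.
    exact: addsmxSl.
  exact: addsmxSr.
rewrite addrC addr_eq0 => /eqP e; exists i0; apply/gen_subP; apply: ord3P.
- exact: addsmxSl.
- rewrite -[v *m A i1]scale1r -(mulVf b0) -scalerA e -scalerN.
  do 2!apply: scalemx_sub; rewrite -scaleN1r; apply: scalemx_sub.
  exact: addsmxSl.
exact: addsmxSr.
Qed.

(** Exchange the roles of arrows and target coordinates: this turns [A] into a pencil of 3 x 3
    matrices. Its kernel vector [v] and the coefficients (a, b), read as a functional on k^2,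
    satisfy that all images of [v] lie in the kernel of this functional. *)
Lemma sub_dim11 (A : arrows k 3 2) :
  exists v : 'rV_3, v != 0 /\ (\rank (gen A v) <= 1)%N.
Proof.
pose F (j : 'I_2) : 'M[k]_3 := \matrix_(p, i) A i p j.
have [//|//|a [b [v [ab v0 ev]]]] := pencil_kernel (F ord0) (F ord_max).
exists v; split=> //; pose s : 'rV[k]_2 := \row_j (if j == ord0 then a else b).
have s0 : s != 0.
  apply: contraTneq ab => /rowP e; have := e ord0; have := e ord_max.
  by rewrite !mxE /= => -> ->; rewrite eqxx.
have : (gen A v <= kermx s^T)%MS.
  apply/gen_subP => i; apply/sub_kermxP/rowP => j; rewrite (ord1 j) !mxE.
  have := congr1 (fun M : 'rV_3 => M 0 i) ev; rewrite !mxE.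
  under eq_bigr do rewrite !mxE.
  move=> e; rewrite big_ord_recl big_ord1 !mxE /=.
  rewrite -[RHS]e !big_distrl /= -big_split /=; apply: eq_bigr => p _.
  rewrite (_ : lift _ _ = ord_max); last exact: val_inj.
  by ring.
move/mxrankS; rewrite mxrank_ker mxrank_tr rank_rV s0; lia.
Qed.

(** If a member of the net kills [s], the three columns [A i *m s^T] are dependent, so their common
    left kernel has dimension at least 4 - 2; the arrows send it into the plane killed by [s]. *)
Lemma sub_dim22 (A : arrows k 4 3) : exists U1 U2,
  [/\ is_sub A U1 U2, (2 <= \rank U1)%N & \rank U2 = 2%N].
Proof.
have [a [b [c [s [abc s0 es]]]]] := net_drop (A i0) (A i1) (A i2).
pose N : 'M[k]_(4, 3) := \matrix_(p, i) (A i *m s^T) p 0.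
pose w : 'rV[k]_3 := \row_i (if i == i0 then a else if i == i1 then b else c).
exists (kermx N), (kermx s^T); split.
- move=> i; apply/sub_kermxP; rewrite -mulmxA; apply/colP => p; rewrite !mxE.
  have := mulmx_ker N => /matrixP/(_ p i); rewrite !mxE => e; rewrite -[RHS]e.
  by apply: eq_bigr => q _; rewrite [N _ _]mxE.
- have w0 : w != 0.
    apply: contraTneq abc => /rowP e.
    have := e i0; have := e i1; have := e i2; rewrite !mxE /= => -> -> ->.
    by rewrite eqxx.
  have key p : a * (A i0 *m s^T) p 0 + b * (A i1 *m s^T) p 0
      + c * (A i2 *m s^T) p 0 = 0.
    have := congr1 (fun M : 'cV_4 => M p 0) es; rewrite !mulmxDl -!scalemxAl.
    move: (A i0 *m s^T) (A i1 *m s^T) (A i2 *m s^T) => X0 X1 X2.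
    by rewrite !mxE.
  have : (w <= kermx N^T)%MS.
    apply/sub_kermxP/rowP => p; rewrite !mxE -[RHS](key p).
    have [e0 e1 e2] : [/\ ord0 = i0, lift ord0 ord0 = i1
        & lift ord0 (lift ord0 ord0) = i2 :> 'I_3] by split; apply: val_inj.
    rewrite !big_ord_recl big_ord0 addr0 addrA e2 e1 e0.
    by rewrite ![w _ _]mxE ![N^T _ _]mxE ![N _ _]mxE.
  move/mxrankS; rewrite rank_rV w0 mxrank_ker mxrank_tr.
  by rewrite mxrank_ker; lia.
by rewrite mxrank_ker mxrank_tr rank_rV s0.
Qed.

End SmallSubs.

(** * Dimension vectors *)

Section Dimensions.
Variable k : closedFieldType.

Lemma not_elem_of_sub m n (A : arrows k m n) U1 U2 : is_sub A U1 U2 ->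
  0 < th (\rank U1) (\rank U2) -> th (\rank U2) (\rank U1) < th n m ->
  ~ elem A.
Proof. by move=> sU h1 h2 [_ _ _]; apply; apply: splits_of_sub sU h1 h2. Qed.

Lemma elem_region m n (A : arrows k m n) : elem A -> (n <= m)%N ->
  (2 * m <= 3 * n)%N -> (m == n) && (m \in [:: 1%N; 2%N]).
Proof.
move=> EA nm mn; have [mn0 _ _ _] := EA; apply/negPn/negP => bad.
have n0 : (0 < n)%N by lia.
(* [is_sub] takes square matrices, hence the square matrix [<<v>>] for the line of [v]. *)
have genv (v : 'rV[k]_m) : is_sub A <<v>>%MS (gen A v).
  move=> i; apply: submx_trans (submxMr (A i) (_ : (<<v>> <= v)%MS)) _.
    by rewrite genmxE.
  by move: i; apply/gen_subP.
have rv (v : 'rV[k]_m) : v != 0 -> \rank <<v>>%MS = 1%N.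
  by move=> v0; rewrite mxrank_gen rank_rV v0.
have [e32|ne32] := boolP ((m == 3) && (n == 2))%N.
  case/andP: e32 => /eqP em /eqP en; subst m n.
  have [v [v0 rg]] := sub_dim11 A; apply: (not_elem_of_sub (genv v)) EA.
    rewrite (rv _ v0) /th; move: rg; rewrite -(ler_nat R).
    by move: lam_gt; lra.
  rewrite (rv _ v0) /th; move: rg; rewrite -(ler_nat R).
  by move: lam_gt; nra.
have [e43|ne43] := boolP ((m == 4) && (n == 3))%N.
  case/andP: e43 => /eqP em /eqP en; subst m n.
  have [U1 [U2 [sU r1 r2]]] := sub_dim22 A; apply: (not_elem_of_sub sU) EA.
    rewrite /th r2; move: r1; rewrite -(ler_nat R).
    by move: lam_gt; nra.
  rewrite /th r2; move: r1; rewrite -(ler_nat R).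
  by move: lam_gt; nra.
have m0 : (0 < m)%N by lia.
have [v [v0 rg]] := sub_dim12 A m0 nm; apply: (not_elem_of_sub (genv v)) EA.
  by rewrite (rv _ v0) /th; move: rg; rewrite -(ler_nat R); move: lam_gt; lra.
rewrite (rv _ v0) /th; move: rg; rewrite -(ler_nat R) => rg.
(* For 4 <= n and 2 m <= 3 n, lam n - m >= 4 lam - 6, which exceeds 2 lam - 1 because lam > 5/2. At
   (3,3) the bound lam > 2 suffices. *)
have : (m == 3) && (n == 3) || (4 <= n)%N.
  by move: bad ne32 ne43; rewrite !inE; lia.
move: (\rank _) rg => r rg.
case/orP => [/andP[/eqP -> /eqP ->]|n4]; first by move: lam_gt; nra.
move: mn n4; rewrite -!(ler_nat R) !natrM => mn n4.
by move: lam_gt; nra.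
Qed.

Lemma kronecker_q_refl (a b c : nat) : (a + b = 3 * c)%N ->
  kronecker_q a c = kronecker_q c b.
Proof.
move=> e; rewrite /kronecker_q.
have -> : a%:Z = 3 * c%:Z - b%:Z by lia.
by ring.
Qed.

Lemma kronecker_qC a b : kronecker_q a b = kronecker_q b a.
Proof. by rewrite /kronecker_q; ring. Qed.

(** Induction on the total dimension. Duality allows [m <= n]; if 2 n <= 3 m, [elem_region] leaves
    (1,1) and (2,2), and otherwise the reflection has first dimension 3 m - n < n, so the total
    drops while [kronecker_q] is preserved. *)
Lemma elem_q m n (A : arrows k m n) : elem A ->
  kronecker_q m n = -1 \/ kronecker_q m n = -4.
Proof.
have [N] := ubnP (m + n); elim: N m n A => // N IH m n A.
wlog le : m n A / (m <= n)%N.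
  move=> W lt EA; case: (leqP m n) => [le|lt']; first exact: W le lt EA.
  rewrite kronecker_qC; apply: (W _ _ (dual A)); first exact: ltnW.
    by rewrite addnC.
  exact: elem_dual.
move=> ltN EA; case: (leqP (2 * n) (3 * m)) => [reg|nreg].
  have := elem_region (elem_dual EA) le reg.
  by rewrite !inE => /andP[/eqP <- /orP[/eqP->|/eqP->]]; [left|right].
have [_ TA _ _] := EA.
have [l [B rAB]] := refl_exists (tors_row_full TA).
have [_ _ _ d] := rAB.
rewrite -(kronecker_q_refl d); apply: (IH _ _ B); first by lia.
exact: (elem_refl rAB EA).
Qed.

(** Subrepresentations have dimension vector (0, b) or (a, N). In a splitting pair, comparison with
    0 excludes the first kind and comparison with the whole excludes the second. *)
Lemma elem_base N (A : arrows k N N) : N \in [:: 1%N; 2%N] ->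
  (forall U1 U2, is_sub A U1 U2 -> U1 != 0 -> \rank U2 = N) -> elem A.
Proof.
move=> hN hA.
have [N0 N2] : (0 < N <= 2)%N /\ (N%:R : R) <= 2.
  by rewrite -[2]/(2%:R) ler_nat; move: hN; rewrite !inE; lia.
have rk U1 U2 : is_sub A U1 U2 -> \rank U1 = 0%N \/
    (0 < \rank U1 <= N)%N /\ \rank U2 = N.
  move=> sU; case: (eqVneq U1 0) => [->|U0]; first by left; rewrite mxrank0.
  right; split; last exact: hA sU U0.
  by rewrite lt0n mxrank_eq0 U0 rank_leq_row.
have N1 : 1 <= N%:R :> R by rewrite -[1]/(1%:R) ler_nat; lia.
split.
- by lia.
- move=> U1 U2 sU; rewrite /th; case: (rk _ _ sU) => [->|[/andP[_ r1] ->]].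
    have := ler0n R (\rank U2); move: lam_gt; nra.
  move: r1; rewrite -(ler_nat R); move: lam_gt; nra.
- move=> U1 U2 sU; rewrite /th; case: (rk _ _ sU) => [->|[/andP[_ r1] ->]].
    have := ler0n R (\rank U2); move: lam_gt; nra.
  move: r1; rewrite -(ler_nat R); move: lam_gt; nra.
case=> V1 [V2 [sV Vn VT VF]].
have := VT _ _ (is_sub0 A) (sub0mx _ _) (sub0mx _ _); rewrite !mxrank0 /th.
have := VF _ _ (is_sub1 A 1%:M) (submx1 _) (submx1 _); rewrite !mxrank1 /th.
case: (rk _ _ sV) => [e0|[r1 e2]].
  rewrite e0; have : (1 <= \rank V2)%N by lia.
  rewrite -(ler_nat R); lra.
rewrite e2; have : (\rank V1 + 1 <= N)%N by lia.
rewrite -(ler_nat R) natrD; move: r1 => /andP[r1 _]; lra.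
Qed.

Lemma elem11 : exists A : arrows k 1 1, elem A.
Proof.
exists (fun=> 1%:M); apply: elem_base => // U1 U2 /(_ ord0); rewrite mulmx1.
move/mxrankS => le U0; apply/eqP; rewrite eqn_leq rank_leq_row.
by apply: leq_trans le; rewrite lt0n mxrank_eq0.
Qed.

(** The images of a vector (v0, v1) are (v0, v1), (0, v0) and (v1, 0), which span k^2 unless the
    vector vanishes. *)
Lemma elem22 : exists A : arrows k 2 2, elem A.
Proof.
pose A : arrows k 2 2 := fun i => if i == i0 then 1%:M else
  if i == i1 then delta_mx 0 1 else delta_mx 1 0.
exists A; apply: elem_base => // U1 U2 sU U0.
apply/eqP; rewrite -[_ == _]/(row_full U2) -sub1mx.
case/rowV0Pn: U0 => v vU v0.
have vA i : (v *m A i <= U2)%MS := submx_trans (submxMr _ vU) (sU i).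
have e1 := vA i1; have e2 := vA i2; have e0 := vA i0.
rewrite /A /= mulmx1 in e0; rewrite /A /= in e1 e2.
have d1 : v *m (delta_mx 0 1 : 'M[k]_2) = v 0 0 *: (delta_mx 0 1 : 'rV[k]_2).
  by apply/rowP => j; rewrite !mxE big_ord_recl big_ord1 !mxE !eqxx /= mulr0 addr0.
have d2 : v *m (delta_mx 1 0 : 'M[k]_2) = v 0 1 *: (delta_mx 0 0 : 'rV[k]_2).
  apply/rowP => j; rewrite !mxE big_ord_recl big_ord1 !mxE !eqxx /= mulr0 add0r.
  by rewrite (_ : lift _ _ = 1) //; apply: val_inj.
have dv : v = v 0 0 *: (delta_mx 0 0 : 'rV[k]_2) + v 0 1 *: delta_mx 0 1.
  rewrite {1}[v]row_sum_delta big_ord_recl big_ord1.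
  by rewrite (_ : lift _ _ = 1) //; apply: val_inj.
have sc (a : k) (w : 'rV_2) : a != 0 -> (a *: w <= U2)%MS -> (w <= U2)%MS.
  by move=> a0; rewrite eqmx_scale.
rewrite d1 in e1; rewrite d2 in e2.
suff [f0 f1] : ((delta_mx 0 0 : 'rV[k]_2) <= U2)%MS /\
    ((delta_mx 0 1 : 'rV[k]_2) <= U2)%MS.
  apply/row_subP => i; rewrite row1; case: i => [[|[|//]] hi].
    by rewrite (_ : Ordinal hi = 0) //; apply: val_inj.
  by rewrite (_ : Ordinal hi = 1) //; apply: val_inj.
case: (eqVneq (v 0 0) 0) => [z0|z0].
  have z1 : v 0 1 != 0.
    by apply: contraNneq v0 => z1; rewrite dv z0 z1 !scale0r addr0.
  split; first exact: sc z1 e2.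
  by apply: sc z1 _; rewrite dv z0 scale0r add0r in e0.
have f1 := sc _ _ z0 e1; split=> //; apply: sc z0 _.
rewrite (_ : _ *: _ = v - v 0 1 *: delta_mx 0 1); last first.
  by apply/esym/eqP; rewrite subr_eq -dv.
by rewrite addmx_sub // -scaleNr scalemx_sub.
Qed.

(** The descent of [elem_q] run backwards. For n <= m and 2 m <= 3 n, the form is at most -n^2,
    which bounds n by 2; beyond that range negativity gives m < 3 n, so (n, 3 n - m) is a smaller
    dimension vector to reflect from. *)
Lemma elem_exists m n : kronecker_q m n = -1 \/ kronecker_q m n = -4 ->
  exists A : arrows k m n, elem A.
Proof.
have [N] := ubnP (m + n); elim: N m n => // N IH m n.
wlog le : m n / (n <= m)%N.
  move=> W lt qmn; case: (leqP n m) => [le|lt']; first exact: W le lt qmn.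
  have [||A EA] := W _ _ (ltnW lt'); first by rewrite addnC.
    by rewrite kronecker_qC.
  by exists (dual A); apply: elem_dual.
move=> ltN qmn; have qneg : kronecker_q m n < 0 by case: qmn => ->.
move: (qneg); rewrite /kronecker_q => q0.
have m0 : (0 < n)%N by rewrite lt0n; apply/eqP => z; move: q0; rewrite z; nia.
case: (leqP (2 * m) (3 * n)) => [reg|nreg].
  have q4 : (n * n <= 4)%N.
    move: qmn; rewrite /kronecker_q; nia.
  have n2 : (n <= 2)%N by nia.
  have : ((m == 1) && (n == 1) || (m == 2) && (n == 2))%N.
    move: qmn; rewrite /kronecker_q; nia.
  by case/orP => /andP[/eqP -> /eqP ->]; [exact: elem11|exact: elem22].
have lt3 : (m < 3 * n)%N by nia.
have d : (m + (3 * n - m) = 3 * n)%N by lia.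
have [||A EA] := IH n (3 * n - m)%N; first by lia.
  by rewrite -(kronecker_q_refl d).
have [_ TA _ _] := EA.
have [l [B rAB]] := refl_exists (tors_row_full TA).
have [_ _ _ d'] := rAB.
have e : l = m by lia.
by subst l; exists B; exact: (elem_refl rAB EA).
Qed.

End Dimensions.

(** * Homomorphisms and finiteness *)

Section Homs.
Variable k : fieldType.
Implicit Types l m n p q r : nat.
Local Notation arrows := (arrows k).

Definition is_hom m n p q (A : arrows m n) (B : arrows p q)
  (P : 'M_(m, p)) (Q : 'M_(n, q)) := forall i, A i *m Q = P *m B i.

Definition hom_nz m n p q (A : arrows m n) (B : arrows p q) :=
  exists P Q, is_hom A B P Q /\ ~ (P = 0 /\ Q = 0).

Definition iso m n p q (A : arrows m n) (B : arrows p q) :=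
  exists P Q P' Q', [/\ is_hom A B P Q, is_hom B A P' Q',
    P *m P' = 1%:M /\ P' *m P = 1%:M & Q *m Q' = 1%:M /\ Q' *m Q = 1%:M].

(** Indecomposability through idempotent endomorphisms, a form that passes directly through
    reflections. *)
Definition indec m n (A : arrows m n) :=
  (0 < m + n)%N /\ forall P Q, is_hom A A P Q -> P *m P = P -> Q *m Q = Q ->
    (P = 0 /\ Q = 0) \/ (P = 1%:M /\ Q = 1%:M).

Lemma is_hom_comp m n p q r l (A : arrows m n) (B : arrows p q) (C : arrows r l)
    P Q P' Q' : is_hom A B P Q -> is_hom B C P' Q' ->
  is_hom A C (P *m P') (Q *m Q').
Proof. by move=> h h' i; rewrite mulmxA h -mulmxA h' mulmxA. Qed.

Lemma is_hom1 m n (A : arrows m n) : is_hom A A 1%:M 1%:M.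
Proof. by move=> i; rewrite mulmx1 mul1mx. Qed.

Lemma is_hom0 m n p q (A : arrows m n) (B : arrows p q) : is_hom A B 0 0.
Proof. by move=> i; rewrite mulmx0 mul0mx. Qed.

Lemma is_hom_dual m n p q (A : arrows m n) (B : arrows p q) P Q :
  is_hom A B P Q -> is_hom (dual B) (dual A) Q^T P^T.
Proof. by move=> h i; rewrite /dual -!trmx_mul h. Qed.

Lemma hom_nz_dual m n p q (A : arrows m n) (B : arrows p q) :
  hom_nz A B -> hom_nz (dual B) (dual A).
Proof.
case=> P [Q [h nz]]; exists Q^T, P^T; split; first exact: is_hom_dual.
by case=> /eqP + /eqP; rewrite !trmx_eq0 => /eqP Q0 /eqP P0; apply: nz.
Qed.

Lemma iso_dual m n p q (A : arrows m n) (B : arrows p q) :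
  iso A B -> iso (dual A) (dual B).
Proof.
case=> P [Q [P' [Q' [h h' [e1 e2] [e3 e4]]]]].
exists Q'^T, P'^T, Q^T, P^T; split; try exact: is_hom_dual.
  by rewrite -!trmx_mul e3 e4 !trmx1.
by rewrite -!trmx_mul e1 e2 !trmx1.
Qed.

Lemma iso_dim m n p q (A : arrows m n) (B : arrows p q) :
  iso A B -> m = p /\ n = q.
Proof.
have sq a b (X : 'M[k]_(a, b)) Y : X *m Y = 1%:M -> (a <= b)%N.
  move/(congr1 mxrank); rewrite mxrank1 => <-.
  by rewrite (leq_trans (mxrankM_maxl _ _)) // rank_leq_col.
case=> P [Q [P' [Q' [h h' [e1 e2] [e3 e4]]]]].
split; apply/eqP; rewrite eqn_leq; apply/andP; split;
  by [exact: sq e1 | exact: sq e2 | exact: sq e3 | exact: sq e4].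
Qed.

Lemma indec_dual m n (A : arrows m n) : indec A -> indec (dual A).
Proof.
case=> mn h; split=> [|P Q hPQ pP qQ]; first by rewrite addnC.
have := h Q^T P^T; rewrite -[A]dualK => /(_ (is_hom_dual hPQ)).
rewrite -!trmx_mul pP qQ => /(_ erefl erefl) [[/eqP e1 /eqP e2]|[e1 e2]].
  by left; rewrite !trmx_eq0 in e1 e2; rewrite (eqP e1) (eqP e2).
by right; split; apply: trmx_inj; rewrite trmx1.
Qed.

Section Lift.
Variables (l m n r p q : nat).
Variables (A : arrows m n) (A' : arrows l m) (B : arrows p q) (B' : arrows r p).
Hypotheses (rA : refl A A') (rB : refl B B').

(** The reflection functor on morphisms: composing the inclusion of the kernel of [A] with [P] lands
    in the kernel of [B], hence factors through [B']. *)
Lemma hom_down P Q : is_hom A B P Q -> exists P', is_hom A' B' P' P.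
Proof.
move=> h; pose X := \mxrow_i (A' i *m P).
have : (X <= \mxrow_i B' i)%MS.
  rewrite (refl_eqmx rB) sub_kermx mul_mxrow_mxcol; apply/eqP.
  under eq_bigr do rewrite -mulmxA -h mulmxA.
  by case: rA => _ _ e _; rewrite -mulmx_suml e mul0mx.
case/submxP => P' e; exists P' => i.
by have := congr1 (fun Y => submxrow Y i) e; rewrite mul_mxrow !mxrowK.
Qed.

Lemma hom_down_uniq P1 P2 P : is_hom A' B' P1 P -> is_hom A' B' P2 P -> P1 = P2.
Proof.
move=> h1 h2; case: rB => _ fB _ _; apply: (row_free_inj fB).
by rewrite /= !mul_mxrow; apply/eq_mxrowP => i; rewrite -h1 -h2.
Qed.

Lemma hom_up_uniq P Q1 Q2 : is_hom A B P Q1 -> is_hom A B P Q2 -> Q1 = Q2.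
Proof.
move=> h1 h2; case: rA => fA _ _ _; apply: (row_full_inj fA).
by rewrite !mxcol_mul; apply/eq_mxcolP => i; rewrite h1 h2.
Qed.

End Lift.

Lemma hom_up l m n r p q (A : arrows m n) (A' : arrows l m) (B : arrows p q)
    (B' : arrows r p) P' P :
  refl A A' -> refl B B' -> is_hom A' B' P' P -> exists Q, is_hom A B P Q.
Proof.
move=> /dual_refl rA /dual_refl rB /is_hom_dual h.
have [X hX] := hom_down rB rA h; exists X^T => i.
by move/is_hom_dual: hX; rewrite !dualK trmxK; apply.
Qed.

Lemma iso_down l m n r p q (A : arrows m n) (A' : arrows l m) (B : arrows p q)
    (B' : arrows r p) : refl A A' -> refl B B' -> iso A B -> iso A' B'.
Proof.
move=> rA rB [P [Q [P' [Q' [h h' [e1 e2] _]]]]].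
have [X hX] := hom_down rA rB h; have [X' hX'] := hom_down rB rA h'.
exists X, P, X', P'; split=> //; split.
  by apply: (hom_down_uniq rA _ (is_hom1 A')); rewrite -e1; apply: is_hom_comp.
by apply: (hom_down_uniq rB _ (is_hom1 B')); rewrite -e2; apply: is_hom_comp.
Qed.

Lemma iso_up l m n r p q (A : arrows m n) (A' : arrows l m) (B : arrows p q)
    (B' : arrows r p) : refl A A' -> refl B B' -> iso A' B' -> iso A B.
Proof.
move=> /dual_refl rA /dual_refl rB /iso_dual i.
by have /iso_dual := iso_down rA rB i; rewrite !dualK.
Qed.

Lemma indec_down l m n (A : arrows m n) (A' : arrows l m) :
  refl A A' -> indec A -> indec A'.
Proof.
move=> rA [mn h]; have [fA fB _ d] := rA; split; first by lia.
move=> X P hXP XX PP; have [Q hQ] := hom_up rA rA hXP.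
have QQ : Q *m Q = Q.
  by apply: (hom_up_uniq rA _ hQ); have := is_hom_comp hQ hQ; rewrite PP.
have [[P0 _]|[P1 _]] := h _ _ hQ PP QQ.
  left; split=> //; apply: (hom_down_uniq rA hXP).
  by rewrite P0; apply: is_hom0.
right; split=> //; apply: (hom_down_uniq rA hXP).
by rewrite P1; apply: is_hom1.
Qed.

Lemma indec_up l m n (A : arrows m n) (A' : arrows l m) :
  refl A A' -> indec A' -> indec A.
Proof.
move=> /dual_refl rA /indec_dual i.
by have /indec_dual := indec_down rA i; rewrite dualK.
Qed.

Lemma hom_nz_down l m n r p q (A : arrows m n) (A' : arrows l m)
    (B : arrows p q) (B' : arrows r p) :
  refl A A' -> refl B B' -> hom_nz A B -> hom_nz A' B'.
Proof.
move=> rA rB [P [Q [h nz]]]; have [X hX] := hom_down rA rB h.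
exists X, P; split=> // -[_ P0]; apply: nz; split=> //.
by apply: (hom_up_uniq rA h); rewrite P0; apply: is_hom0.
Qed.

Lemma hom_nz_up l m n r p q (A : arrows m n) (A' : arrows l m)
    (B : arrows p q) (B' : arrows r p) :
  refl A A' -> refl B B' -> hom_nz A' B' -> hom_nz A B.
Proof.
move=> /dual_refl rA /dual_refl rB /hom_nz_dual h.
by have /hom_nz_dual := hom_nz_down rB rA h; rewrite !dualK.
Qed.

Lemma refl_exists_up l m (B : arrows l m) : row_free (\mxrow_i B i) ->
  exists n (A : arrows m n), refl A B.
Proof.
move=> fB.
have [|n [A]] := @refl_exists _ _ _ (dual B).
  by rewrite /row_full /dual -tr_mxrow mxrank_tr; exact: fB.
by move/dual_refl; rewrite dualK; exists n, (dual A).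
Qed.

(** A functional [f] vanishing on all images, with a vector [w] where it takes the value 1, gives an
    idempotent onto a simple projective summand; indecomposability makes it the identity. *)
Lemma indec_not_full m n (A : arrows m n) : indec A ->
  ~~ row_full (\mxcol_i A i) -> m = 0%N /\ n = 1%N.
Proof.
case=> mn h nf.
have : kermx (\mxcol_i A i)^T != 0.
  rewrite -mxrank_eq0 mxrank_ker mxrank_tr; move: nf; rewrite /row_full.
  by have := rank_leq_col (\mxcol_i A i); lia.
case/rowV0Pn => f /sub_kermxP fS f0.
have Af i : A i *m f^T = 0.
  have := congr1 trmx fS; rewrite trmx_mul trmxK trmx0 mxcol_mul => e.
  by have := congr1 (fun X => submxcol X i) e; rewrite mxcolK submxcol0.
have [j fj] : exists j, f 0 j != 0.
  apply/existsP; apply: contraR f0; rewrite negb_exists => /forallP e.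
  by apply/eqP/rowP => j; rewrite mxE; apply/eqP; move: (e j); rewrite negbK.
pose w : 'rV[k]_n := (f 0 j)^-1 *: delta_mx 0 j.
have wf : w *m f^T = 1%:M.
  rewrite /w -scalemxAl -rowE; apply/matrixP => a b.
  by rewrite !mxE !ord1 mulVf.
have [|||[_ Q0]|[e1 e2]] := h 0 (f^T *m w).
- by move=> i; rewrite mulmxA Af !mul0mx.
- by rewrite mulmx0.
- by rewrite mulmxA -(mulmxA f^T w) wf mulmx1.
- have : w *m (f^T *m w) *m f^T = 0 by rewrite Q0 mulmx0 mul0mx.
  rewrite mulmxA wf mul1mx wf => /eqP.
  by rewrite -mxrank_eq0 mxrank1.
have m0 : m = 0%N by have := congr1 mxrank e1; rewrite mxrank1 mxrank0.
split=> //; have : (n <= 1)%N.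
  rewrite -(@mxrank1 k n) -e2 (leq_trans (mxrankM_maxl _ _)) //.
  exact: rank_leq_col.
by lia.
Qed.

Lemma indec_not_free m n (A : arrows m n) : indec A ->
  ~~ row_free (\mxrow_i A i) -> m = 1%N /\ n = 0%N.
Proof.
move/indec_dual/indec_not_full.
rewrite /row_full /row_free /dual -tr_mxrow mxrank_tr => h /h [-> ->].
by [].
Qed.

Lemma iso_row_free l m r p (B : arrows l m) (C : arrows r p) : iso B C ->
  row_free (\mxrow_i B i) -> row_free (\mxrow_i C i).
Proof.
case=> P [Q [P' [Q' [h h' [e1 e2] [e3 e4]]]]] fB.
rewrite -kermx_eq0; apply/rowV0P => w /sub_kermxP; rewrite mul_mxrow => e.
have wC i : w *m C i = 0.
  by have := congr1 (fun X => submxrow X i) e; rewrite mxrowK submxrow0.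
have : (w *m P') *m \mxrow_i B i = 0.
  rewrite mul_mxrow -(mxrow0 _ (q_ := fun=> m)); apply/eq_mxrowP => i.
  by rewrite -mulmxA -h' mulmxA wC mul0mx.
move/eqP; rewrite mulmx_free_eq0 // => /eqP wP.
by rewrite -[w]mulmx1 -e2 mulmxA wP mul0mx.
Qed.

Lemma iso_01 m n p q (A : arrows m n) (B : arrows p q) :
  m = 0%N /\ n = 1%N -> p = 0%N /\ q = 1%N -> iso A B.
Proof.
move=> [? ?] [? ?]; subst.
by exists 1%:M, 1%:M, 1%:M, 1%:M; split; rewrite ?mul1mx // => i;
  rewrite (flatmx0 (A i)) (flatmx0 (B i)) mul0mx mulmx0.
Qed.

(** * Finiteness and the torsion conditions *)

Record mrep := MRep { d1 : nat; d2 : nat; ar : arrows d1 d2 }.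

Definition fin_to m n (A : arrows m n) := exists (N : nat) (F : 'I_N -> mrep),
  forall p q (Y : arrows p q), indec Y -> hom_nz Y A ->
    exists i, iso Y (ar (F i)).

Definition fin_from m n (A : arrows m n) := exists (N : nat) (F : 'I_N -> mrep),
  forall p q (Y : arrows p q), indec Y -> hom_nz A Y ->
    exists i, iso Y (ar (F i)).

Definition simple01 : arrows 0 1 := fun=> 0.

Lemma indec_simple01 : indec simple01.
Proof.
split=> // P Q _ _ QQ; rewrite (flatmx0 P) [1%:M]flatmx0.
have -> : Q = (Q 0 0)%:M.
  by apply/matrixP => i j; rewrite !mxE !ord1.
have : Q 0 0 * (Q 0 0 - 1) = 0.
  move/matrixP: QQ => /(_ 0 0); rewrite mxE big_ord1 => e.
  by rewrite mulrBr mulr1 e subrr.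
move/eqP; rewrite mulf_eq0 subr_eq0 => /orP[/eqP ->|/eqP ->].
  by left; rewrite raddf0.
by right.
Qed.

(** Each reflection shrinks the first dimension of the offending quotient, so the simple projective
    is reached. Going back up, the finite list is reflected and gains only [simple01]. *)
Lemma not_tors_fin m n (A : arrows m n) U1 U2 : indec A -> is_sub A U1 U2 ->
  th m n < th (\rank U1) (\rank U2) -> fin_to A.
Proof.
have [N] := ubnP (m - \rank U1); elim: N m n A U1 U2 => // N IH m n A U1 U2.
move=> ltN iA sU lt; case: (boolP (row_full (\mxcol_i A i))) => [fA|nfA].
  have [l [A' rA]] := refl_exists fA.
  have [sU' lt' dec] := not_tors_refl rA sU lt.
  have [|M [F hF]] := IH _ _ _ _ _ _ (indec_down rA iA) sU' lt'; first lia.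
  (* [G i] undoes the reflection on [F i]; [simple01] is a default value where this is
     impossible. *)
  have /choice[G hG] : forall i, exists Z : mrep,
      row_free (\mxrow_j ar (F i) j) ->
      exists p (C : arrows (d2 (F i)) p), refl C (ar (F i)) /\ Z = MRep C.
    move=> i; case: (boolP (row_free (\mxrow_j ar (F i) j))) => [f|_].
      have [p [C rC]] := refl_exists_up f.
      by exists (MRep C) => _; exists p, C.
    by exists (MRep simple01).
  exists M.+1, (fun i => if unlift ord0 i is Some j then G j else MRep simple01).
  move=> p q Y iY hY; case: (boolP (row_full (\mxcol_i Y i))) => [fY|nfY].
    have [r [Y' rY]] := refl_exists fY; have [_ fY' _ _] := rY.
    have [j isoj] := hF _ _ _ (indec_down rY iY) (hom_nz_down rY rA hY).
    have [s [C [rC eG]]] := hG j (iso_row_free isoj fY').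
    by exists (lift ord0 j); rewrite liftK eG /=; apply: iso_up rY rC isoj.
  by exists ord0; rewrite unlift_none; apply: iso_01 (indec_not_full iY nfY) _.
(* Here [A] is simple projective. A map to it vanishes on the images of the arrows of [Y], so [Y]
   cannot have jointly surjective arrows. *)
exists 1%N, (fun=> MRep simple01) => p q Y iY [P [Q [h nz]]].
exists ord0; apply: iso_01 => //.
have [m0 n1] := indec_not_full iA nfA; subst m n.
apply: indec_not_full iY _; apply/negP => fY; apply: nz.
split; first exact: thinmx0.
apply: (row_full_inj fY); rewrite mulmx0 mxcol_mul -(mxcol0 (p_ := fun=> p)).
by apply/eq_mxcolP => i; rewrite h (flatmx0 (A i)) mulmx0.
Qed.

Lemma hom_lift_up l m n r p (A : arrows m n) (A' : arrows l m) (Y' : arrows r p) :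
  refl A A' -> indec Y' -> (r < p)%N -> hom_nz Y' A' ->
  exists q (Y : arrows p q), [/\ indec Y, (p < q)%N & hom_nz Y A].
Proof.
move=> rA iY lt h; case: (boolP (row_free (\mxrow_i Y' i))) => [fY|nfY]; last first.
  by have [? ?] := indec_not_free iY nfY; lia.
have [q [Y rY]] := refl_exists_up fY; have [_ _ _ d] := rY.
by exists q, Y; split; [exact: indec_up rY iY|lia|exact: hom_nz_up rY rA h].
Qed.

(** Torsion representations can be reflected down any number of times. A map from [simple01] at the
    bottom, lifted back up, has a source that grows at each step. *)
Lemma tors_unbounded N m n (A : arrows m n) : indec A -> tors A -> (0 < n)%N ->
  exists p q (Y : arrows p q), [/\ indec Y, (p < q)%N, (N < q)%N & hom_nz Y A].
Proof.
elim: N m n A => [|N IH] m n A iA TA n0.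
  exists 0%N, 1%N, simple01; split=> //; first exact: indec_simple01.
  exists 0, (delta_mx 0 (Ordinal n0)); split.
    by move=> i; rewrite !flatmx0.
  case=> _ /matrixP/(_ 0 (Ordinal n0)); rewrite !mxE !eqxx => /eqP.
  by rewrite oner_eq0.
have fA := tors_row_full TA; have [l [A' rA]] := refl_exists fA.
have [_ _ _ d] := rA.
have m0 : (0 < m)%N by lia.
have [p [q [Y [iY lt Nq hY]]]] :=
  IH _ _ _ (indec_down rA iA) (tors_refl rA TA) m0.
have [s [Z [iZ lt' hZ]]] := hom_lift_up rA iY lt hY.
by exists q, s, Z; split=> //; lia.
Qed.

Lemma tors_not_fin m n (A : arrows m n) : indec A -> tors A -> ~ fin_to A.
Proof.
move=> iA TA [N [F hF]].
(* One extra reflection ensures a nonzero second dimension, as [tors_unbounded] requires. *)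
have fA := tors_row_full TA; have [l [A' rA]] := refl_exists fA.
have [_ _ _ d] := rA; have [mn _] := iA.
have m0 : (0 < m)%N by lia.
have [p [q [Y [iY lt Nq hY]]]] :=
  tors_unbounded (\max_i d2 (F i)) (indec_down rA iA) (tors_refl rA TA) m0.
have [s [Z [iZ lt' hZ]]] := hom_lift_up rA iY lt hY.
have [i /iso_dim[_ e]] := hF _ _ _ iZ hZ.
have := @leq_bigmax _ (fun i => d2 (F i)) i.
by rewrite /= -e leqNgt (ltn_trans Nq lt').
Qed.

Lemma fin_toP m n (A : arrows m n) : indec A -> fin_to A <-> ~ tors A.
Proof.
move=> iA; split=> [f TA|nT]; first exact: tors_not_fin iA TA f.
apply: contrapT => nf; apply: nT => U1 U2 sU; rewrite leNgt; apply/negP => lt.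
exact: nf (not_tors_fin iA sU lt).
Qed.

Lemma fin_from_dual m n (A : arrows m n) : fin_from A <-> fin_to (dual A).
Proof.
split=> -[N [F hF]]; exists N, (fun i => MRep (dual (ar (F i)))).
  move=> p q Y /indec_dual iY /hom_nz_dual; rewrite dualK => h.
  by have [i /iso_dual] := hF _ _ _ iY h; rewrite dualK; exists i.
move=> p q Y /indec_dual iY /hom_nz_dual h.
by have [i /iso_dual] := hF _ _ _ iY h; rewrite dualK; exists i.
Qed.

Lemma fin_fromP m n (A : arrows m n) : indec A -> fin_from A <-> ~ cotors A.
Proof.
move=> /indec_dual iA; rewrite fin_from_dual (fin_toP iA).
by split=> h h'; apply: h; [exact: dual_tors|rewrite -[A]dualK; exact: dual_cotors].
Qed.

End Homs.

(** * Biproducts and extensions *)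

Section Extensions.
Variable k : fieldType.
Implicit Types m n : nat.
Local Notation arrows := (arrows k).

(** [kermx (P *m cokermx U)] is the preimage of [U] under [P]. *)
Lemma is_sub_preim m n p q (A : arrows m n) (B : arrows p q) P Q U1 U2 :
  is_hom A B P Q -> is_sub B U1 U2 ->
  is_sub A (kermx (P *m cokermx U1)) (kermx (Q *m cokermx U2)).
Proof.
move=> h s i; apply/sub_kermxP.
rewrite mulmxA -[_ *m A i *m Q]mulmxA h mulmxA.
have /submxP[D ->] : (kermx (P *m cokermx U1) *m P <= U1)%MS.
  by rewrite submxE -mulmxA mulmx_ker.
rewrite -!mulmxA; have := s i; rewrite submxE => /eqP.
by rewrite -mulmxA => ->; rewrite mulmx0.
Qed.

Lemma sub_preim m p q (P : 'M[k]_(m, p)) (U : 'M_p) (x : 'M_(q, m)) :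
  (x <= kermx (P *m cokermx U))%MS = (x *m P <= U)%MS.
Proof. by rewrite sub_kermx mulmxA submxE. Qed.

Lemma rank_preim m p (P : 'M[k]_(m, p)) (U : 'M_p) : row_full P ->
  (\rank (kermx (P *m cokermx U)) + p = \rank U + m)%N.
Proof.
move=> fP; set W := kermx _.
have WP : (W *m P :=: U)%MS.
  apply/eqmxP/andP; split; first by rewrite -sub_preim.
  rewrite -[U]mulmx1 -(mulVpmx fP) mulmxA; apply: submxMr.
  by rewrite sub_preim -mulmxA mulVpmx // mulmx1.
have kW : (kermx P <= W)%MS by rewrite sub_preim mulmx_ker sub0mx.
have := mxrank_mul_ker W P; rewrite WP.
have -> : \rank (W :&: kermx P)%MS = (m - p)%N.
  by move/capmx_idPr: kW => ->; rewrite mxrank_ker (eqP fP).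
by have := rank_leq_row P; rewrite (eqP fP); lia.
Qed.

Lemma is_sub_img m n p q (A : arrows m n) (B : arrows p q) P Q U1 U2 :
  is_hom A B P Q -> is_sub A U1 U2 -> is_sub B <<U1 *m P>>%MS <<U2 *m Q>>%MS.
Proof.
move=> h s i; rewrite genmxE.
apply: submx_trans (submxMr (B i) (_ : (_ <= U1 *m P)%MS)) _.
  by rewrite genmxE.
by rewrite -mulmxA -h mulmxA submxMr.
Qed.

Lemma tors_quo m n p q (A : arrows m n) (B : arrows p q) P Q :
  is_hom A B P Q -> row_full P -> row_full Q -> tors A -> tors B.
Proof.
move=> h fP fQ TA U1 U2 sU; have := TA _ _ (is_sub_preim h sU).
have := rank_preim U1 fP; have := rank_preim U2 fQ.
move: (\rank (kermx (P *m _))) (\rank (kermx (Q *m _))) => a b.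
move=> /(congr1 (fun x => x%:R : R)) e2 /(congr1 (fun x => x%:R : R)) e1.
move: e1 e2; rewrite /th !natrD => e1 e2.
have -> : a%:R = (\rank U1)%:R + m%:R - p%:R :> R by rewrite -e1 addrK.
by lra.
Qed.

Lemma cotors_sub m n p q (A : arrows m n) (B : arrows p q) P Q :
  is_hom A B P Q -> row_free P -> row_free Q -> cotors B -> cotors A.
Proof.
move=> h fP fQ FB U1 U2 sU; have := FB _ _ (is_sub_img h sU).
by rewrite !mxrank_gen !mxrankMfree.
Qed.

(** * Biproducts, idempotents and summands *)

Definition bip a b c (i : 'M[k]_(a, c)) (p : 'M_(c, a)) (j : 'M_(b, c))
    (q : 'M_(c, b)) :=
  [/\ i *m p = 1%:M, j *m q = 1%:M, i *m q = 0, j *m p = 0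
    & p *m i + q *m j = 1%:M].

Definition biprod a a' b b' c c' (A : arrows a a') (B : arrows b b')
    (C : arrows c c') :=
  exists i i' p p' j j' q q', [/\ is_hom A C i i' /\ is_hom C A p p',
    is_hom B C j j' /\ is_hom C B q q', bip i p j q & bip i' p' j' q'].

(** Cancel the column and row bases in the rank factorization of [P *m P = P]. *)
Lemma idem_bip c (P : 'M[k]_c) : P *m P = P ->
  row_base P *m col_base P = 1%:M.
Proof.
move=> PP; apply: (row_full_inj (col_base_full P)).
apply: (row_free_inj (row_base_free P)).
by rewrite /= mulmxA mulmx_base -mulmxA mulmx_base PP mulmx1 mulmx_base.
Qed.

Lemma bip_compl a c (i : 'M[k]_(a, c)) (p : 'M_(c, a)) :
  i *m p = 1%:M -> let E := 1%:M - p *m i in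
  E *m E = E /\ bip i p (row_base E) (col_base E).
Proof.
move=> ip E.
have iE : i *m E = 0 by rewrite mulmxBr mulmx1 mulmxA ip mul1mx subrr.
have Ep : E *m p = 0 by rewrite mulmxBl mul1mx -mulmxA ip mulmx1 subrr.
have EE : E *m E = E.
  by rewrite {1}/E mulmxBl mul1mx -mulmxA iE mulmx0 subr0.
split=> //; split=> //; first exact: idem_bip.
- apply: (row_free_inj (row_base_free E)).
  by rewrite /= -mulmxA mulmx_base iE mul0mx.
- apply: (row_full_inj (col_base_full E)).
  by rewrite /= mulmxA mulmx_base Ep mulmx0.
by rewrite mulmx_base addrC subrK.
Qed.

Lemma idem_hom m n (A : arrows m n) P Q :
  is_hom A A P Q -> P *m P = P -> Q *m Q = Q ->
  exists A' : arrows (\rank P) (\rank Q), is_hom A' A (row_base P) (row_base Q) /\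
    is_hom A A' (col_base P) (col_base Q).
Proof.
move=> h PP QQ; have eP := idem_bip PP; have eQ := idem_bip QQ.
have rP : row_base P *m P = row_base P.
  have := mulmxA (row_base P) (col_base P) (row_base P).
  by rewrite eP mul1mx mulmx_base.
have Qc : Q *m col_base Q = col_base Q.
  have := mulmxA (col_base Q) (row_base Q) (col_base Q).
  by rewrite eQ mulmx1 mulmx_base.
exists (fun i => row_base P *m A i *m col_base Q); split=> i.
  by rewrite -mulmxA mulmx_base -mulmxA h mulmxA rP.
rewrite /= (mulmxA (col_base P) (row_base P *m A i)).
by rewrite (mulmxA (col_base P)) mulmx_base -h -mulmxA Qc.
Qed.

Lemma split_biprod a a' c c' (A : arrows a a') (C : arrows c c') i i' p p' :
  is_hom A C i i' -> is_hom C A p p' -> i *m p = 1%:M -> i' *m p' = 1%:M ->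
  exists B : arrows (\rank (1%:M - p *m i)) (\rank (1%:M - p' *m i')),
    biprod A B C.
Proof.
move=> hi hp ip ip'; have [EE b] := bip_compl ip; have [EE' b'] := bip_compl ip'.
have h : is_hom C C (1%:M - p *m i) (1%:M - p' *m i').
  by move=> x; rewrite mulmxBr mulmxBl mulmx1 mul1mx mulmxA hp -!mulmxA hi.
have [B [hj hq]] := idem_hom h EE EE'.
exists B, i, i', p, p', (row_base (1%:M - p *m i)),
  (row_base (1%:M - p' *m i')), (col_base (1%:M - p *m i)),
  (col_base (1%:M - p' *m i')).
by [].
Qed.

Lemma idem_biprod c c' (C : arrows c c') P Q : is_hom C C P Q ->
  P *m P = P -> Q *m Q = Q ->
  exists (A : arrows (\rank P) (\rank Q))
         (B : arrows (\rank (1%:M - P)) (\rank (1%:M - Q))), biprod A B C.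
Proof.
move=> h PP QQ; have [A [hi hp]] := idem_hom h PP QQ.
have := split_biprod hi hp (idem_bip PP) (idem_bip QQ).
by rewrite !mulmx_base; exists A.
Qed.

Lemma bip_sym a b c (i : 'M_(a, c)) p (j : 'M_(b, c)) q :
  bip i p j q -> bip j q i p.
Proof. by case=> *; split; rewrite // addrC. Qed.

Lemma biprod_sym a a' b b' c c' (A : arrows a a') (B : arrows b b')
  (C : arrows c c') : biprod A B C -> biprod B A C.
Proof.
case=> i [i' [p [p' [j [j' [q [q' [h1 h2 /bip_sym b1 /bip_sym b2]]]]]]]].
by exists j, j', q, q', i, i', p, p'.
Qed.

Lemma bip_dim a b c (i : 'M_(a, c)) p (j : 'M_(b, c)) q :
  bip i p j q -> c = (a + b)%N.
Proof.
case=> e1 e2 e3 e4 e5.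
have h1 : row_mx p q *m col_mx i j = 1%:M by rewrite mul_row_col.
have h2 : col_mx i j *m row_mx p q = 1%:M.
  by rewrite mul_col_row e1 e2 e3 e4 -scalar_mx_block.
have r1 := mxrankM_maxl (row_mx p q) (col_mx i j).
have r2 := mxrankM_maxl (col_mx i j) (row_mx p q).
rewrite h1 mxrank1 in r1; rewrite h2 mxrank1 in r2.
have := leq_trans r1 (rank_leq_col _); have := leq_trans r2 (rank_leq_col _).
lia.
Qed.

(** [U] is an extension of its projection [U *m p] by [U :&: kermx p], on which [q] is injective. *)
Lemma bip_rank a b c m (i : 'M_(a, c)) p (j : 'M_(b, c)) q (U : 'M_(m, c)) :
  bip i p j q ->
  \rank U = (\rank (U *m p) + \rank ((U :&: kermx p)%MS *m q))%N.
Proof.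
case=> _ _ _ _ e; rewrite -(mxrank_mul_ker U p); congr (_ + _)%N.
rewrite -[in LHS](mxrank_mul_ker (U :&: kermx p)%MS q) -[RHS]addn0.
congr (_ + _)%N; apply/eqP; rewrite mxrank_eq0; apply/rowV0P => v.
rewrite !sub_capmx => /andP[/andP[_ /sub_kermxP vp] /sub_kermxP vq].
by rewrite -[v]mulmx1 -e mulmxDr !mulmxA vp vq !mul0mx addr0.
Qed.

Lemma biprod_sub a a' b b' c c' (A : arrows a a') (B : arrows b b')
    (C : arrows c c') U1 U2 : biprod A B C -> is_sub C U1 U2 ->
  exists V1 V2 W1 W2, [/\ is_sub A V1 V2, is_sub B W1 W2,
    \rank U1 = (\rank V1 + \rank W1)%N & \rank U2 = (\rank V2 + \rank W2)%N].
Proof.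
case=> i [i' [p [p' [j [j' [q [q' [[h1 h2] [h3 h4] b1 b2]]]]]]]] sU.
exists <<U1 *m p>>%MS, <<U2 *m p'>>%MS, <<(U1 :&: kermx p)%MS *m q>>%MS,
  <<(U2 :&: kermx p')%MS *m q'>>%MS.
split; rewrite ?mxrank_gen; [exact: is_sub_img h2 sU | | exact: bip_rank b1
  | exact: bip_rank b2].
apply: (is_sub_img h4) => x; rewrite sub_capmx; apply/andP; split.
  by apply: submx_trans (sU x); apply: submxMr; exact: capmxSl.
apply/sub_kermxP; rewrite -mulmxA h2 mulmxA.
suff -> : (U1 :&: kermx p)%MS *m p = 0 by rewrite mul0mx.
by apply/sub_kermxP; exact: capmxSr.
Qed.

Lemma biprod_dim a a' b b' c c' (A : arrows a a') (B : arrows b b')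
    (C : arrows c c') : biprod A B C -> c = (a + b)%N /\ c' = (a' + b')%N.
Proof.
by case=> i [i' [p [p' [j [j' [q [q' [_ _ /bip_dim ? /bip_dim ?]]]]]]]].
Qed.

Lemma biprod_tors a a' b b' c c' (A : arrows a a') (B : arrows b b')
    (C : arrows c c') : biprod A B C -> tors A -> tors B -> tors C.
Proof.
move=> bC TA TB U1 U2 /(biprod_sub bC)[V1 [V2 [W1 [W2 [sV sW -> ->]]]]].
by have [-> ->] := biprod_dim bC; rewrite !thD lerD ?TA ?TB.
Qed.

Lemma biprod_cotors a a' b b' c c' (A : arrows a a') (B : arrows b b')
    (C : arrows c c') : biprod A B C -> cotors A -> cotors B -> cotors C.
Proof.
move=> bC TA TB U1 U2 /(biprod_sub bC)[V1 [V2 [W1 [W2 [sV sW -> ->]]]]].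
by rewrite thD addr_ge0 ?TA ?TB.
Qed.

Definition summand a a' c c' (A : arrows a a') (C : arrows c c') :=
  exists i i' p p', [/\ is_hom A C i i', is_hom C A p p', i *m p = 1%:M
    & i' *m p' = 1%:M].

Lemma summand_biprod a a' b b' c c' (A : arrows a a') (B : arrows b b')
    (C : arrows c c') : biprod A B C -> summand A C.
Proof.
case=> i [i' [p [p' [j [j' [q [q' [[h1 h2] _ [b1 _ _ _ _] [b2 _ _ _ _]]]]]]]]].
by exists i, i', p, p'.
Qed.

Lemma summand_trans a a' b b' c c' (A : arrows a a') (B : arrows b b')
    (C : arrows c c') : summand A B -> summand B C -> summand A C.
Proof.
case=> i [i' [p [p' [hi hp e e']]]] [j [j' [q [q' [hj hq f f']]]]].
exists (i *m j), (i' *m j'), (q *m p), (q' *m p'); split.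
- exact: is_hom_comp hi hj.
- exact: is_hom_comp hq hp.
- by rewrite mulmxA -(mulmxA i) f mulmx1.
by rewrite mulmxA -(mulmxA i') f' mulmx1.
Qed.

Lemma summand_refl c c' (C : arrows c c') : summand C C.
Proof.
exists 1%:M, 1%:M, 1%:M, 1%:M.
by split; rewrite ?mul1mx //; exact: is_hom1.
Qed.

Lemma full_of_right_inv a c (i : 'M[k]_(a, c)) p :
  i *m p = 1%:M -> row_free i /\ row_full p.
Proof.
move=> e; split; first by apply/row_freeP; exists p.
by apply/row_fullP; exists i.
Qed.

Lemma summand_tors a a' c c' (A : arrows a a') (C : arrows c c') :
  summand A C -> tors C -> tors A.
Proof.
case=> i [i' [p [p' [hi hp /full_of_right_inv[_ f] /full_of_right_inv[_ f']]]]].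
exact: tors_quo hp f f'.
Qed.

Lemma summand_cotors a a' c c' (A : arrows a a') (C : arrows c c') :
  summand A C -> cotors C -> cotors A.
Proof.
case=> i [i' [p [p' [hi hp /full_of_right_inv[f _] /full_of_right_inv[f' _]]]]].
exact: cotors_sub hi f f'.
Qed.

Lemma biprod_indec a a' b b' c c' (A : arrows a a') (B : arrows b b')
    (C : arrows c c') : biprod A B C -> (0 < a + a')%N -> (0 < b + b')%N ->
  ~ indec C.
Proof.
case=> i [i' [p [p' [j [j' [q [q' [[h1 h2] _ B1 B2]]]]]]]] a0 b0 [_ h].
have z x y (u : 'M[k]_(x, y)) v w : u *m v = 1%:M -> u *m w *m v = 0 ->
    w = 1%:M -> x = 0%N.
  move=> e f ew; move: f; rewrite ew mulmx1 e => /(congr1 mxrank).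
  by rewrite mxrank1 mxrank0.
case: B1 B2 => [e1 e2 e3 e4 e5] [f1 f2 f3 f4 f5].
have [|||[E1 E2]|[E1 E2]] := h (p *m i) (p' *m i').
- exact: is_hom_comp h2 h1.
- by rewrite mulmxA -(mulmxA p) e1 mulmx1.
- by rewrite mulmxA -(mulmxA p') f1 mulmx1.
- have u0 : a = 0%N.
    have := congr1 (mulmx i \o mulmxr p) E1.
    rewrite /= mul0mx mulmx0 -mulmxA e1 mulmx1 e1 => /(congr1 mxrank).
    by rewrite mxrank1 mxrank0.
  have u1 : a' = 0%N.
    have := congr1 (mulmx i' \o mulmxr p') E2.
    rewrite /= mul0mx mulmx0 -mulmxA f1 mulmx1 f1 => /(congr1 mxrank).
    by rewrite mxrank1 mxrank0.
  by lia.
have u0 : b = 0%N.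
  have := congr1 (mulmx j \o mulmxr q) E1.
  rewrite /= -mulmxA e3 !mulmx0 mul1mx e2 => /(congr1 mxrank).
  by rewrite mxrank1 mxrank0.
have u1 : b' = 0%N.
  have := congr1 (mulmx j' \o mulmxr q') E2.
  rewrite /= -mulmxA f3 !mulmx0 mul1mx f2 => /(congr1 mxrank).
  by rewrite mxrank1 mxrank0.
by lia.
Qed.

Lemma not_indec_biprod c c' (C : arrows c c') : (0 < c + c')%N -> ~ indec C ->
  exists a a' b b' (A : arrows a a') (B : arrows b b'),
    [/\ biprod A B C, (0 < a + a')%N & (0 < b + b')%N].
Proof.
move=> c0 nI; apply: contrapT => nB; apply: nI; split=> // P Q h PP QQ.
have [A [B bAB]] := idem_biprod h PP QQ.
have [/eqP|r] := posnP (\rank P + \rank Q).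
  by rewrite addn_eq0 !mxrank_eq0 => /andP[/eqP -> /eqP ->]; left.
have [/eqP|r'] := posnP (\rank (1%:M - P) + \rank (1%:M - Q)).
  rewrite addn_eq0 !mxrank_eq0 !subr_eq0 => /andP[/eqP <- /eqP <-].
  by right.
by case: nB; do 4!eexists; exists A, B; split.
Qed.

(** Splitting off summands by induction on the total dimension; this replaces a full decomposition
    into indecomposables. *)
Lemma indec_summand (good : forall m n, arrows m n -> Prop) :
  (forall a a' b b' c c' (A : arrows a a') (B : arrows b b') (C : arrows c c'),
    biprod A B C -> good _ _ A -> good _ _ B -> good _ _ C) ->
  (forall A : arrows 0 0, good _ _ A) ->
  forall c c' (C : arrows c c'), ~ good _ _ C ->
  exists a a' (A : arrows a a'), [/\ summand A C, indec A & ~ good _ _ A].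
Proof.
move=> gB g0 c c' C; have [N] := ubnP (c + c').
elim: N c c' C => // N IH c c' C ltN ng.
have [iC|nC] := pselect (indec C).
  by exists c, c', C; split=> //; exact: summand_refl.
have c0 : (0 < c + c')%N.
  rewrite lt0n; apply/eqP => e; apply: ng.
  have [e1 e2] : c = 0%N /\ c' = 0%N by lia.
  by subst c c'; exact: g0.
have [a [a' [b [b' [A [B [bC a0 b0]]]]]]] := not_indec_biprod c0 nC.
have [d d'] := biprod_dim bC.
have rec x x' (X : arrows x x') : (x + x' < N)%N -> summand X C ->
    ~ good _ _ X -> exists a a' (A : arrows a a'),
    [/\ summand A C, indec A & ~ good _ _ A].
  move=> lt sX nX; have [y [y' [Y [sY iY nY]]]] := IH _ _ X lt nX.
  by exists y, y', Y; split=> //; exact: summand_trans sY sX.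
have [gA|nA] := pselect (good _ _ A); last first.
  by apply: rec nA; [lia | exact: summand_biprod bC].
have [gB'|nB] := pselect (good _ _ B); first by case: ng; exact: gB bC gA gB'.
by apply: rec nB; [lia | exact: summand_biprod (biprod_sym bC)].
Qed.

(** * Exact sequences and splitting pairs *)

Definition exact_seq a a' b b' c c' (A : arrows a a') (C : arrows c c')
    (B : arrows b b') :=
  exists i i' p p', [/\ is_hom A C i i' /\ is_hom C B p p',
    row_free i /\ row_free i', row_full p /\ row_full p'
    & (i :=: kermx p)%MS /\ (i' :=: kermx p')%MS].

(** Half of the regularity of each end comes from [splits]; the other half is inherited by
    subrepresentations or by quotients of [A]. *)
Lemma splits_exact m n (A : arrows m n) V1 V2 : splits A V1 V2 ->
  tors A -> cotors A -> exists a a' b b' (X : arrows a a') (Y : arrows b b'),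
  [/\ exact_seq X A Y, (0 < a + a')%N, (0 < b + b')%N, tors X /\ cotors X
    & tors Y /\ cotors Y].
Proof.
case=> sV Vn VT VF TA FA.
have kerP x (V : 'M[k]_x) : exists p : 'M_(x, x - \rank V),
    row_full p /\ (kermx p :=: V)%MS.
  rewrite -mxrank_coker; exists (col_base (cokermx V)).
  split; first exact: col_base_full.
  apply/eqmxP; rewrite andbC -mxrank_leqif_eq.
    rewrite mxrank_ker (eqP (col_base_full _)) mxrank_coker.
    by have := rank_leq_row V; lia.
  apply/sub_kermxP; apply: (row_free_inj (row_base_free (cokermx V))).
  by rewrite /= -mulmxA mulmx_base mulmx_coker mul0mx.
have [p [fp kp]] := kerP _ V1; have [p' [fp' kp']] := kerP _ V2.
have [i [fi ei]] : exists i : 'M_(\rank V1, m), row_free i /\ (i :=: V1)%MS.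
  by exists (row_base V1); rewrite row_base_free; split=> //; exact: eq_row_base.
have [i' [fi' ei']] : exists i : 'M_(\rank V2, n), row_free i /\ (i :=: V2)%MS.
  by exists (row_base V2); rewrite row_base_free; split=> //; exact: eq_row_base.
(* [X] is the restriction to [V] in row bases, and [Y] the induced quotient, [pinvmx p] choosing
   representatives. *)
pose X : arrows _ _ := fun x => i *m A x *m pinvmx i'.
pose Y : arrows _ _ := fun x => pinvmx p *m A x *m p'.
have hX : is_hom X A i i'.
  move=> x; rewrite mulmxKpV // ei'.
  by apply: submx_trans (submxMr _ _) (sV x); rewrite ei.
have hY : is_hom A Y p p'.
  move=> x; have : (1%:M - p *m pinvmx p) *m A x *m p' = 0.
    apply/sub_kermxP; rewrite kp'; apply: submx_trans (sV x); apply: submxMr.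
    rewrite -kp; apply/sub_kermxP.
    by rewrite mulmxBl mul1mx -mulmxA mulVpmx // mulmx1 subrr.
  by rewrite !mulmxBl mul1mx /Y !mulmxA => /eqP; rewrite subr_eq0 => /eqP.
have e : exact_seq X A Y.
  exists i, i', p, p'; split=> //; split.
    exact: eqmx_trans ei (eqmx_sym kp).
  exact: eqmx_trans ei' (eqmx_sym kp').
have r1 := rank_leq_row V1; have r2 := rank_leq_row V2.
do 4!eexists; exists X, Y; split=> //; [lia | lia | split | split].
- move=> U1 U2 sU; have := VT _ _ (is_sub_img hX sU).
  rewrite !genmxE !mxrankMfree //; apply.
    by rewrite (submx_trans (submxMl _ _)) // ei.
  by rewrite (submx_trans (submxMl _ _)) // ei'.
- exact: cotors_sub hX fi fi' FA.
- exact: tors_quo hY fp fp' TA.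
move=> U1 U2 sU; have := VF _ _ (is_sub_preim hY sU).
have h1 : V1 *m p = 0 by apply/sub_kermxP; rewrite kp.
have h2 : V2 *m p' = 0 by apply/sub_kermxP; rewrite kp'.
rewrite !sub_preim h1 h2 !sub0mx => /(_ isT isT).
have := rank_preim U1 fp; have := rank_preim U2 fp'.
move: (\rank (kermx (p' *m _))) (\rank (kermx (p *m _))) => u v e2 e1.
have -> : v = (\rank U1 + \rank V1)%N by lia.
have -> : u = (\rank U2 + \rank V2)%N by lia.
by rewrite /th !natrD; lra.
Qed.

Lemma exact_splits a a' b b' m n (X : arrows a a') (A : arrows m n)
    (Y : arrows b b') : exact_seq X A Y -> (0 < a + a')%N -> (0 < b + b')%N ->
  tors X -> cotors Y -> exists V1 V2, splits A V1 V2.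
Proof.
case=> i [i' [p [p' [[hX hY] [fi fi'] [fp fp'] [ki ki']]]]] a0 b0 TX FY.
exists <<i>>%MS, <<i'>>%MS.
have r1 : \rank i = a by apply/eqP.
have r2 : \rank i' = a' by apply/eqP.
have d1 : (a + b = m)%N.
  have : \rank i = \rank (kermx p) by rewrite ki.
  rewrite r1 mxrank_ker (eqP fp).
  by have := rank_leq_row p; rewrite (eqP fp); lia.
have d2 : (a' + b' = n)%N.
  have : \rank i' = \rank (kermx p') by rewrite ki'.
  rewrite r2 mxrank_ker (eqP fp').
  by have := rank_leq_row p'; rewrite (eqP fp'); lia.
split; rewrite ?mxrank_gen ?r1 ?r2.
- move=> x; rewrite genmxE.
  apply: submx_trans (submxMr (A x) (_ : (_ <= i)%MS)) _; first by rewrite genmxE.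
  by rewrite -hX submxMl.
- by lia.
- move=> U1 U2 sU; rewrite !genmxE => /submxP[W1 e1] /submxP[W2 e2].
  subst U1 U2.
  have := TX <<W1>>%MS <<W2>>%MS; rewrite !mxrank_gen !mxrankMfree //; apply.
  move=> x; rewrite genmxE.
  apply: submx_trans (submxMr (X x) (_ : (_ <= W1)%MS)) _; first by rewrite genmxE.
  by rewrite -(submxMfree _ _ fi') -mulmxA hX mulmxA; exact: sU.
move=> U1 U2 sU; rewrite !genmxE => iU1 iU2.
have := FY _ _ (is_sub_img hY sU); rewrite !mxrank_gen.
have rk x y z (j : 'M[k]_(z, x)) (P : 'M[k]_(x, y)) (U : 'M[k]_x) :
    (j :=: kermx P)%MS -> (j <= U)%MS -> \rank U = (\rank (U *m P) + \rank j)%N.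
  move=> kj jU; rewrite -(mxrank_mul_ker U P); congr (_ + _)%N.
  have /capmx_idPr -> : (kermx P <= U)%MS by rewrite -kj.
  by rewrite kj.
rewrite (rk _ _ _ _ _ _ ki iU1) (rk _ _ _ _ _ _ ki' iU2) r1 r2 /th !natrD.
by lra.
Qed.

End Extensions.

(** * Translation to vector spaces and linear maps *)

Section LfunMatrix.
Variable k : fieldType.
Implicit Types aT rT vT : vectType k.

Lemma f2mx_inj aT rT : injective (@f2mx k aT rT).
Proof. by case=> A [B] /= ->. Qed.

Lemma f2mx_comp aT vT rT (g : 'Hom(vT, rT)) (f : 'Hom(aT, vT)) :
  f2mx (g \o f)%VF = f2mx f *m f2mx g.
Proof.
rewrite /comp_lfun unlock /=; apply/row_matrixP => i.
by rewrite !rowE mul_rV_lin1 /= unlock /= !r2vK mulmxA.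
Qed.

Lemma f2mx_id vT : f2mx (\1%VF : 'Hom(vT, vT)) = 1%:M.
Proof.
rewrite /id_lfun unlock /=; apply/row_matrixP => i.
by rewrite !rowE mul_rV_lin1 /= r2vK mulmx1.
Qed.

Lemma f2mx0 aT rT : f2mx (0 : 'Hom(aT, rT)) = 0.
Proof.
rewrite [0]/(linfun \0) unlock /=; apply/row_matrixP => i.
by rewrite !rowE mul_rV_lin1 /= linear0 mulmx0.
Qed.

Lemma mx2vsP vT m n (A : 'M[k]_(m, dim vT)) (B : 'M[k]_(n, dim vT)) :
  (mx2vs A = mx2vs B :> {vspace vT}) <-> (A :=: B)%MS.
Proof.
split=> [/(congr1 vs2mx) /= /genmxP/eqmxP //|/eqmxP/genmxP e].
exact: val_inj.
Qed.

Lemma lker_eq0 aT rT (f : 'Hom(aT, rT)) : lker f = 0%VS <-> row_free (f2mx f).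
Proof.
rewrite mx2vsP linear0 -kermx_eq0; split=> [/eqmx_eq0 ->|/eqP ->] //.
by apply/eqmxP/andP; rewrite !sub0mx.
Qed.

Lemma limg_eqv aT rT vT (f : 'Hom(aT, rT)) (g : 'Hom(rT, vT)) :
  limg f = lker g <-> (f2mx f :=: kermx (f2mx g))%MS.
Proof.
rewrite unlock /lker /lfun_img_def mx2vsP.
have e : (vs2mx fullv *m f2mx f :=: f2mx f)%MS.
  by apply: eqmx_trans (eqmxMr _ (mx2vsK _)) _; rewrite mul1mx.
by split=> h; apply: eqmx_trans h => //; exact: eqmx_sym.
Qed.

Lemma limg_full aT rT (f : 'Hom(aT, rT)) : limg f = fullv <-> row_full (f2mx f).
Proof.
rewrite unlock /lfun_img_def mx2vsP.
have e : (vs2mx fullv *m f2mx f :=: f2mx f)%MS.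
  by apply: eqmx_trans (eqmxMr _ (mx2vsK _)) _; rewrite mul1mx.
rewrite -sub1mx; split=> [h|h]; first by rewrite -e h.
by apply/eqmxP/andP; rewrite submx1 e.
Qed.

End LfunMatrix.

(* A copy of row vectors whose dimension is n by computation ('rV_n has
   dimension 1 * n). *)
Definition rvs (k : fieldType) (n : nat) : Type := 'rV[k]_n.
HB.instance Definition _ (k : fieldType) n := GRing.Lmodule.copy (rvs k n) 'rV[k]_n.

Fact rvs_axiom (k : fieldType) n : SemiVector.axiom n (rvs k n).
Proof. by exists (fun v : rvs k n => v : 'rV[k]_n); [split | exists id]. Qed.

HB.instance Definition _ (k : fieldType) n :=
  LSemiModule_hasFinDim.Build k (rvs k n) (rvs_axiom k n).

Section Translation.
Variable k : fieldType.
Implicit Types M N : krep k.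

Definition arr M : arrows k (dim (vs1 M)) (dim (vs2 M)) := fun i =>
  if i == i0 then f2mx (alpha M) else
  if i == i1 then f2mx (beta M) else f2mx (gamma M).

(** Using [rvs] makes the dimensions compute to [m] and [n], so that [arr (rep A) = A] is well
    typed. *)
Definition rep m n (A : arrows k m n) : krep k :=
  let hom i : 'Hom(rvs k m, rvs k n) := @Hom k (rvs k m) (rvs k n) (A i) in
  @KRep k (rvs k m) (rvs k n) (hom i0) (hom i1) (hom i2).

Lemma arr_rep m n (A : arrows k m n) : arr (rep A) = A.
Proof. by apply/funext; apply: ord3P. Qed.

Lemma dim_vectorE M : dim_vector M = (dim (vs1 M), dim (vs2 M)).
Proof. by rewrite /dim_vector !dimvf. Qed.

Lemma nonzero_repP M : nonzero_rep M <-> (0 < dim (vs1 M) + dim (vs2 M))%N.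
Proof.
rewrite /nonzero_rep dim_vectorE; split=> [h|h [e1 e2]].
  rewrite lt0n; apply/eqP => e; apply: h; congr (_, _); lia.
by rewrite e1 e2 in h.
Qed.

Lemma khom_is_hom M N (f : khom M N) :
  is_hom (arr M) (arr N) (f2mx (hom1 f)) (f2mx (hom2 f)).
Proof.
apply: ord3P; rewrite /arr /= -!f2mx_comp.
- by rewrite hom_alpha.
- by rewrite hom_beta.
by rewrite hom_gamma.
Qed.

Lemma is_hom_khom M N P Q : is_hom (arr M) (arr N) P Q ->
  exists f : khom M N, f2mx (hom1 f) = P /\ f2mx (hom2 f) = Q.
Proof.
move=> h; pose F1 : 'Hom(vs1 M, vs1 N) := Hom P.
pose F2 : 'Hom(vs2 M, vs2 N) := Hom Q.
have e0 : (F2 \o alpha M = alpha N \o F1)%VF.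
  by apply: f2mx_inj; rewrite !f2mx_comp; exact: h i0.
have e1 : (F2 \o beta M = beta N \o F1)%VF.
  by apply: f2mx_inj; rewrite !f2mx_comp; exact: h i1.
have e2 : (F2 \o gamma M = gamma N \o F1)%VF.
  by apply: f2mx_inj; rewrite !f2mx_comp; exact: h i2.
by exists (KHom e0 e1 e2).
Qed.

Lemma Hom_nonzeroP M N : Hom_nonzero M N <-> hom_nz (arr M) (arr N).
Proof.
split=> [[f nz]|[P [Q [/is_hom_khom[f [<- <-]] nz]]]].
  exists (f2mx (hom1 f)), (f2mx (hom2 f)); split; first exact: khom_is_hom.
  by case=> e1 e2; apply: nz; split; apply: f2mx_inj; rewrite f2mx0.
by exists f; case=> e1 e2; apply: nz; rewrite e1 e2 !f2mx0.
Qed.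

Lemma kisoP M N : kiso M N <-> iso (arr M) (arr N).
Proof.
split=> [[f [g [e1 e2 e3 e4]]]|].
  exists (f2mx (hom1 f)), (f2mx (hom2 f)), (f2mx (hom1 g)), (f2mx (hom2 g)).
  by split; rewrite -?f2mx_comp ?e1 ?e2 ?e3 ?e4 ?f2mx_id //; exact: khom_is_hom.
case=> P [Q [P' [Q' [/is_hom_khom[f [<- <-]] /is_hom_khom[g [<- <-]]]]]].
rewrite -!f2mx_comp -!f2mx_id => -[e1 e2] [e3 e4].
by exists f, g; split; apply: f2mx_inj.
Qed.

(** * Direct sums as biproducts *)

Section Biproduct.
Variables U V : vectType k.

Definition inl_fun (u : U) : U * V := (u, 0).
Definition inr_fun (v : V) : U * V := (0, v).
Definition fst_fun (w : U * V) := w.1.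
Definition snd_fun (w : U * V) := w.2.

Fact inl_is_linear : linear inl_fun.
Proof. by move=> a u v; congr (_, _); rewrite /= scaler0 addr0. Qed.
Fact inr_is_linear : linear inr_fun.
Proof. by move=> a u v; congr (_, _); rewrite /= scaler0 addr0. Qed.
Fact fst_is_linear : linear fst_fun. Proof. by []. Qed.
Fact snd_is_linear : linear snd_fun. Proof. by []. Qed.

HB.instance Definition _ := GRing.isLinear.Build k U (U * V)%type *:%R inl_fun inl_is_linear.
HB.instance Definition _ := GRing.isLinear.Build k V (U * V)%type *:%R inr_fun inr_is_linear.
HB.instance Definition _ := GRing.isLinear.Build k (U * V)%type U *:%R fst_fun fst_is_linear.
HB.instance Definition _ := GRing.isLinear.Build k (U * V)%type V *:%R snd_fun snd_is_linear.

Lemma bip_lfun : bip (f2mx (linfun inl_fun)) (f2mx (linfun fst_fun))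
  (f2mx (linfun inr_fun)) (f2mx (linfun snd_fun)).
Proof.
split; rewrite -?f2mx_comp -?f2mx_id -?f2mx0; try congr f2mx.
- by apply/lfunP => u; rewrite !lfunE /= !lfunE.
- by apply/lfunP => u; rewrite !lfunE /= !lfunE.
- by apply/lfunP => u; rewrite !lfunE /= !lfunE.
- by apply/lfunP => u; rewrite !lfunE /= !lfunE.
have f2mxD (f g : 'Hom((U * V)%type, (U * V)%type)) :
    f2mx f + f2mx g = f2mx (f + g).
  rewrite [(f + g)%R]/(linfun _) unlock /=; apply/row_matrixP => i.
  by rewrite !rowE mul_rV_lin1 /= mulmxDr linearD /= unlock /= !r2vK.
rewrite f2mxD; congr f2mx; apply/lfunP => -[u v].
by rewrite !lfunE /= !lfunE /= !lfunE; congr (_, _); rewrite ?addr0 ?add0r.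
Qed.

End Biproduct.

Lemma dsum_biprod X Y : biprod (arr X) (arr Y) (arr (dsum X Y)).
Proof.
do 8!eexists; split; last exact: bip_lfun; last exact: bip_lfun.
  split; apply: ord3P; rewrite /arr /= -!f2mx_comp; congr f2mx;
    apply/lfunP => u; rewrite !lfunE /= !lfunE /= ?lfunE //;
    by rewrite /dsum_fun /= linear0.
split; apply: ord3P; rewrite /arr /= -!f2mx_comp; congr f2mx;
  apply/lfunP => u; rewrite !lfunE /= !lfunE /= ?lfunE //;
  by rewrite /dsum_fun /= linear0.
Qed.

Lemma biprod_iso a a' b b' c c' d d' (A : arrows k a a') (B : arrows k b b')
    (C : arrows k c c') (D : arrows k d d') :
  iso C D -> biprod A B D -> biprod A B C.
Proof.
case=> P [Q [P' [Q' [hP hP' [e1 e2] [e3 e4]]]]].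
case=> i [i' [p [p' [j [j' [q [q' [[h1 h2] [h3 h4] b1 b2]]]]]]]].
exists (i *m P'), (i' *m Q'), (P *m p), (Q *m p'), (j *m P'), (j' *m Q'),
  (P *m q), (Q *m q').
have bipM x y z w (u : 'M[k]_(x, z)) v (u' : 'M_(y, z)) v' (X : 'M_(w, z)) X' :
    X *m X' = 1%:M -> X' *m X = 1%:M -> bip u v u' v' ->
    bip (u *m X') (X *m v) (u' *m X') (X *m v').
  move=> f1 f2 [f3 f4 f5 f6 f7].
  split; try by rewrite mulmxA -(mulmxA _ X') f2 mulmx1.
  by rewrite !mulmxA -mulmxDl -!(mulmxA X) -mulmxDr f7 mulmx1.
split; [split; first exact: is_hom_comp h1 hP'; exact: is_hom_comp hP h2
  | split; first exact: is_hom_comp h3 hP'; exact: is_hom_comp hP h4 | |];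
  exact: bipM.
Qed.

Lemma biprod_uniq a a' b b' c c' d d' (A : arrows k a a') (B : arrows k b b')
    (C : arrows k c c') (D : arrows k d d') :
  biprod A B C -> biprod A B D -> iso C D.
Proof.
case=> i [i' [p [p' [j [j' [q [q' [[h1 h2] [h3 h4] b1 b2]]]]]]]].
case=> u [u' [v [v' [w [w' [x [x' [[g1 g2] [g3 g4] c1 c2]]]]]]]].
have homD (m1 n1 m2 n2 : nat) (X : arrows k m1 n1) (Y : arrows k m2 n2) P Q P' Q' :
    is_hom X Y P Q -> is_hom X Y P' Q' -> is_hom X Y (P + P') (Q + Q').
  by move=> h h' y; rewrite mulmxDr mulmxDl h h'.
have inv (m1 m2 m3 m4 : nat) (I : 'M[k]_(m1, m3)) P (J : 'M_(m2, m3)) Q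
    (U : 'M_(m1, m4)) V (W : 'M_(m2, m4)) X : bip I P J Q -> bip U V W X ->
    (P *m U + Q *m W) *m (V *m I + X *m J) = 1%:M.
  move=> [_ _ _ _ f] [f1 f2 f3 f4 _].
  rewrite mulmxDl !mulmxDr !mulmxA -!(mulmxA P) -!(mulmxA Q) f1 f2 f3 f4.
  by rewrite !(mulmx0, mul0mx, mulmx1, mul1mx, addr0, add0r).
exists (p *m u + q *m w), (p' *m u' + q' *m w'), (v *m i + x *m j),
  (v' *m i' + x' *m j').
split.
- exact: homD (is_hom_comp h2 g1) (is_hom_comp h4 g3).
- exact: homD (is_hom_comp g2 h1) (is_hom_comp g4 h3).
- by split; exact: inv.
by split; exact: inv.
Qed.

Lemma kiso_dsumP M X Y :
  kiso M (dsum X Y) <-> biprod (arr X) (arr Y) (arr M).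
Proof.
rewrite kisoP; split=> [/biprod_iso|h]; first by apply; exact: dsum_biprod.
exact: biprod_uniq h (dsum_biprod X Y).
Qed.

Lemma indecomposableP M : indecomposable M <-> indec (arr M).
Proof.
split=> [[/nonzero_repP nz h]|iM].
  apply: contrapT => /(not_indec_biprod nz)[a [a' [b [b' [A [B [bM a0 b0]]]]]]].
  apply: (h (rep A) (rep B)); rewrite ?nonzero_repP //.
  by rewrite kiso_dsumP !arr_rep.
split; first by apply/nonzero_repP; case: iM.
move=> A B /nonzero_repP a0 /nonzero_repP b0 /kiso_dsumP bM.
exact: biprod_indec bM a0 b0 iM.
Qed.

Lemma direct_summandP X M : direct_summand X M <-> summand (arr X) (arr M).
Proof.
split=> [[Y /kiso_dsumP]|[i [i' [p [p' [hi hp e e']]]]]].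
  exact: summand_biprod.
have [B bB] := split_biprod hi hp e e'.
by exists (rep B); rewrite kiso_dsumP arr_rep.
Qed.

Lemma finitely_manyP (P : forall m n, arrows k m n -> Prop) :
  finitely_many_classes (fun X => P _ _ (arr X)) <->
  exists (n : nat) (F : 'I_n -> mrep k), forall p q (Y : arrows k p q),
    P _ _ Y -> exists i, iso Y (ar (F i)).
Proof.
split=> -[n [F hF]].
  exists n, (fun i => MRep (arr (F i))) => p q Y PY.
  by have [|i /kisoP] := hF (rep Y); rewrite arr_rep //; exists i.
exists n, (fun i => rep (ar (F i))) => X PX.
by have [i hi] := hF _ _ _ PX; exists i; rewrite kisoP arr_rep.
Qed.

Lemma finitely_many_eq (P Q : krep k -> Prop) : (forall X, P X <-> Q X) ->
  finitely_many_classes P <-> finitely_many_classes Q.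
Proof. by move=> e; split=> -[n [F h]]; exists n, F => X /e; exact: h. Qed.

Lemma preprojectiveP X : indec (arr X) -> preprojective X <-> ~ tors (arr X).
Proof.
move=> iX; rewrite -(fin_toP iX) /preprojective.
rewrite (@finitely_many_eq _ (fun Y => indec (arr Y) /\ hom_nz (arr Y) (arr X))).
  rewrite (finitely_manyP (fun _ _ Y => indec Y /\ hom_nz Y (arr X))).
  split=> -[n [F h]]; exists n, F => p q Y; first by move=> *; apply: h.
  by case=> *; apply: h.
by move=> Y; rewrite indecomposableP Hom_nonzeroP.
Qed.

Lemma preinjectiveP X : indec (arr X) -> preinjective X <-> ~ cotors (arr X).
Proof.
move=> iX; rewrite -(fin_fromP iX) /preinjective.
rewrite (@finitely_many_eq _ (fun Y => indec (arr Y) /\ hom_nz (arr X) (arr Y))).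
  rewrite (finitely_manyP (fun _ _ Y => indec Y /\ hom_nz (arr X) Y)).
  split=> -[n [F h]]; exists n, F => p q Y; first by move=> *; apply: h.
  by case=> *; apply: h.
by move=> Y; rewrite indecomposableP Hom_nonzeroP.
Qed.

(** If a torsion condition failed for [M], it would fail for an indecomposable summand, which would
    then be preprojective or preinjective. Conversely both conditions pass to summands. *)
Lemma regularP M : regular_rep M <-> tors (arr M) /\ cotors (arr M).
Proof.
split=> [h|[TM FM] X /indecomposableP iX /direct_summandP sX]; last first.
  rewrite preprojectiveP // preinjectiveP //; split; apply.
    exact: summand_tors sX TM.
  exact: summand_cotors sX FM.
have rk0 (U : 'M[k]_0) : \rank U = 0%N by rewrite flatmx0 mxrank0.
split; apply: contrapT => nT.
  have [A U1 U2 _|a [a' [A [sA iA nA]]]] := indec_summand (@biprod_tors k) _ nT.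
    by rewrite !rk0.
  have [||+ _] := h (rep A).
  - by rewrite indecomposableP arr_rep.
  - by rewrite direct_summandP arr_rep.
  by apply; rewrite preprojectiveP arr_rep.
have [A U1 U2 _|a [a' [A [sA iA nA]]]] := indec_summand (@biprod_cotors k) _ nT.
  by rewrite !rk0 /th mulr0 subrr.
have [||_] := h (rep A).
- by rewrite indecomposableP arr_rep.
- by rewrite direct_summandP arr_rep.
by apply; rewrite preinjectiveP arr_rep.
Qed.

Lemma short_exact_seq M' M M'' (f : khom M' M) (g : khom M M'') :
  short_exact f g -> exact_seq (arr M') (arr M) (arr M'').
Proof.
case=> -[/lker_eq0 a1 /lker_eq0 a2] [/limg_eqv b1 /limg_eqv b2].
case=> /limg_full c1 /limg_full c2.
exists (f2mx (hom1 f)), (f2mx (hom2 f)), (f2mx (hom1 g)), (f2mx (hom2 g)).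
by split=> //; split; exact: khom_is_hom.
Qed.

Lemma exact_seq_short M' M M'' : exact_seq (arr M') (arr M) (arr M'') ->
  exists (f : khom M' M) (g : khom M M''), short_exact f g.
Proof.
case=> i [i' [p [p' [[/is_hom_khom[f [<- <-]] /is_hom_khom[g [<- <-]]]]]]].
case=> a1 a2 [b1 b2] [c1 c2]; exists f, g; split.
- by rewrite !lker_eq0.
- by rewrite !limg_eqv.
by rewrite !limg_full.
Qed.

Lemma elementaryP M : elementary M <-> elem (arr M).
Proof.
split=> [[/nonzero_repP nz /regularP[TM FM] nE]|[nz TM FM nS]].
  split=> // -[V1 [V2 sV]]; apply: nE.
  have [a [a' [b [b' [X [Y [e a0 b0 [TX FX] [TY FY]]]]]]]] := splits_exact sV TM FM.
  have [|f [g fg]] := @exact_seq_short (rep X) M (rep Y).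
    by rewrite !arr_rep.
  exists (rep X), (rep Y), f, g; split=> //; try exact/nonzero_repP.
    by rewrite regularP arr_rep.
  by rewrite regularP arr_rep.
split; [exact/nonzero_repP | exact/regularP |].
case=> M' [M'' [f [g [fg /nonzero_repP a0 /nonzero_repP b0]]]].
move=> /regularP[TX _] /regularP[_ FY]; apply: nS.
exact: exact_splits (short_exact_seq fg) a0 b0 TX FY.
Qed.

End Translation.

Theorem mainTheorem2 (k : closedFieldType) (x y : nat) :
  (exists M : krep k, elementary M /\ dim_vector M = (x, y)) <->
  (kronecker_q x y = -1 \/ kronecker_q x y = -4).
Proof.
split=> [[M [/elementaryP EM]]|/(@elem_exists k)[A EA]].
  by rewrite dim_vectorE => -[<- <-]; exact: elem_q EM.
by exists (rep A); rewrite elementaryP dim_vectorE arr_rep.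
Qed.
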